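(* Let $G$ be a finitely generated infinite group with polynomial growth, and let $F$ be a fixed finite symmetric generating set of $G$ containing the identity, with length function $\tau=\tau_F$. Suppose that $0\le\alpha\le 1$ and $C>0$, and let $\sigma_{\alpha,C}(x)=e^{C\tau(x)^\alpha}$ $(x\in G)$ be the exponential weight. Then $\ell^1(G,\sigma_{\alpha,C})$ is isomorphic to an operator algebra if and only if $0<\alpha<1$.
   Context: All groups are discrete and all spaces are complex. For a finitely generated group $G$ with a finite symmetric generating set $F$ containing the identity $e$, put $F^n=\{u_1\cdots u_n: u_i\in F\}$. $G$ has polynomial growth if $|F^n|$ is bounded by a polynomial in $n$. The length function is $\tau(x)=\tau_F(x)=\inf\{n\ge 1: x\in F^n\}$ for $x\ne e$, and $\tau(e)=0$. For $\alpha=0$ the weight $\sigma_{0,C}$ is the constant $e^C$. A weight on $G$ is a function $\omega:G\to(0,\infty)$ with $\omega(xy)\le\omega(x)\omega(y)$ for all $x,y\in G$. The weighted group algebra $\ell^1(G,\omega)$ is the convolution algebra of functions $g:G\to\mathbb{C}$ with $\|g\|=\sum_{x\in G}|g(x)|\omega(x)<\infty$. An operator algebra is a norm-closed subalgebra of $B(H)$, the bounded operators on a Hilbert space $H$. A Banach algebra is isomorphic to an operator algebra if there is a bounded algebra isomorphism with bounded inverse from it onto an operator algebra. *)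

(* Defs.v *)
From HB Require Import structures.
From mathcomp Require Import all_boot all_order all_algebra finmap.
From mathcomp Require Import complex.
From mathcomp Require Import all_classical all_reals all_analysis.
From mathcomp Require Import summability.

Set Implicit Arguments.
Unset Strict Implicit.
Unset Printing Implicit Defensive.

Import Order.TTheory GRing.Theory Num.Theory.
Import numFieldNormedType.Exports.

Local Open Scope fset_scope.
Local Open Scope classical_set_scope.
Local Open Scope complex_scope.
Local Open Scope ring_scope.

Section Growth.
Variables (R : realType) (G : groupType).
Implicit Types (F : {fset G}) (x : G) (n : nat).

Definition generates F : Prop :=
  forall S : {pred G}, group_closed S -> {subset F <= S} -> forall x, x \in S.

Definition fset_power F n : {fset G} :=
  iter n (fun A => [fset (u * v)%g | u in F, v in A]) [fset 1%g].

Definition polynomial_growth F : Prop :=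
  exists p : {poly R}, forall n, (#|` fset_power F n|)%:R <= p.[n%:R].

Definition word_length F x : R :=
  if x == 1%g then 0
  else inf [set n%:R | n in [set n | (1 <= n)%N /\ x \in fset_power F n]].

(* [powR] has [0 `^ 0 = 1], so the weight is the constant [expR C] for
   [alpha = 0], at the identity of [G] as well. *)
Definition exp_weight F (alpha C : R) x : R :=
  expR (C * word_length F x `^ alpha).

End Growth.

Section WeightedGroupAlgebra.
Variables (R : realType) (G : groupType) (w : G -> R).
Implicit Types f g : G -> R[i]^o.

(* [`|z|] is an element of [R[i]]; [complex.Re] reads it as a real number. *)
Definition l1_sum g : \bar R :=
  \esum_(x in [set: G]) (complex.Re `|g x| * w x)%:E.

Definition l1 : set (G -> R[i]^o) := [set g | (l1_sum g < +oo)%E].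

Definition l1_norm g : R := fine (l1_sum g).

(* [summability.sum] is the limit of the net of finite partial sums; for a
   weight [w] the series converges absolutely whenever [f] and [g] are in
   [l1], since [w x <= w y * w (y^-1 * x)] with [0 < w x]. *)
Definition convolution f g : G -> R[i]^o :=
  fun x => summability.sum (fun y => (f y * g (y^-1 * x)%g) : R[i]^o).

End WeightedGroupAlgebra.

Record hilbertSpace (R : realType) := HilbertSpace {
  hilbert_sort :> completeNormedModType R[i] ;
  inner : {dot hilbert_sort for (@Num.conj R[i])} ;
  inner_norm : forall u : hilbert_sort, `|u| ^+ 2 = inner u u
}.

Section OperatorAlgebra.
Variables (R : realType) (H : hilbertSpace R).
Implicit Types (S T : H -> H) (A : set (H -> H)).

Definition hnorm (u : H) : R := complex.Re `|u|.

Definition bounded_operator T : Prop :=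
  linear T /\ exists M : R, forall u, hnorm (T u) <= M * hnorm u.

Definition opnorm T : R := sup [set hnorm (T u) | u in [set u | hnorm u <= 1]].

Definition operator_algebra A : Prop :=
  [/\ A `<=` bounded_operator,
      A 0 /\ (forall (a : R[i]) S T, A S -> A T -> A (a *: S + T)),
      forall S T, A S -> A T -> A (S \o T)
    & forall T, bounded_operator T ->
        (forall eps : R, 0 < eps -> exists2 S, A S & opnorm (T - S) < eps) ->
        A T].

End OperatorAlgebra.

(* The Banach algebra is the subset [B] of the ambient space [V], with product
   [mul] and norm [nrm]; what these do outside [B] is irrelevant. *)
Definition isomorphic_to_operator_algebra (R : realType) (V : lmodType R[i])
    (B : set V) (mul : V -> V -> V) (nrm : V -> R) : Prop :=
  exists (H : hilbertSpace R) (A : set (H -> H)) (Phi : V -> H -> H),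
  [/\ operator_algebra A,
      set_bij B A Phi,
      forall (a : R[i]) f g, B f -> B g ->
        Phi (a *: f + g) = a *: Phi f + Phi g,
      forall f g, B f -> B g -> Phi (mul f g) = Phi f \o Phi g
    & (exists M : R, forall f, B f -> opnorm (Phi f) <= M * nrm f) /\
      (exists M : R, forall f, B f -> nrm f <= M * opnorm (Phi f))].

(* Main.v *)
(* Necessity.  Let S_i and T_j be the images of the normalized point masses at
   x_i and y_j.  If the products x_i y_j are distinct and
   w(x_i) w(y_j) <= K w(x_i y_j), then the norm of the sum of a_ij S_i T_j is at
   least of the order of the sum of |a_ij|, whereas for a matrix of signs a with
   P rows and N orthogonal columns Cauchy-Schwarz bounds it by a multiple of
   P sqrt N.  For alpha = 0 or 1 such x_i and y_j are cut out of a long geodesic.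

   Sufficiency.  For 0 < alpha < 1, the inequality
   (s + t)^alpha <= t^alpha + alpha s^alpha for s <= t gives a square-summable h
   with w(vx) <= h(x)^2 w(v) w(x) or w(vx) <= h(v) w(v) w(x) for all v and x.
   Consequently the translate by v of a functional f with |f| <= w on the group
   is the sum of a functional bounded on a weighted l^2 space and of h(v) w(v)
   times a functional of the same kind as f.  Iterating along words V in G yields
   functionals f_V, and the l^2 norm together with (sum_V c_V^2 |f_V|^2)^(1/2),
   where c_V is a constant to the length of V times the product of the h(v), is
   a Hilbertian norm for which translation by v has norm O(w(v)).  The direct sum
   over all sign functions f = +-w recovers the weighted l^1 norm. *)
Require Import Defs.
From HB Require Import structures.
From mathcomp Require Import all_boot all_order all_algebra finmap.
From mathcomp Require Import complex.
From mathcomp Require Import all_classical all_reals all_analysis.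
From mathcomp Require Import summability zify ring lra.

Set Implicit Arguments.
Unset Strict Implicit.
Unset Printing Implicit Defensive.

Import Order.TTheory GRing.Theory Num.Theory.
Import numFieldNormedType.Exports.

Local Open Scope fset_scope.
Local Open Scope classical_set_scope.
Local Open Scope complex_scope.
Local Open Scope ring_scope.

(** * Unconditional sums *)

Section RealNorm.
Variable R : realType.

(** The sign matrix has all P = 2^N sign vectors as its rows; the lower bound P N and the upper
    bound P sqrt N, both up to constants, conflict for large N.

    A functional bounded by h^2 w is continuous for the l^2 norm with weight h w because h is
    square-summable, which is why one alternative carries the square. The functional left by the
    other alternative need not be continuous for that norm, so the norm has to contain it, and then
    all its iterates along words. The factor h(v) gained at each letter makes the c_V
    square-summable over all words. The gap in the weight comes from alpha < 1, the
    square-summability of h from polynomial growth and alpha > 0.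

    The Hilbert space is the closed span of the images of the point masses in a larger l^2 space. On
    all of that space the formula for translation by v is bounded but not multiplicative: applying
    v' and then v reads coordinates at words beginning with v', v, whereas v v' reads words
    beginning with the single letter v v'. The two agree on images of point masses, hence on their
    closed span. *)

Definition rnorm (V : normedZmodType R[i]) (v : V) : R := complex.Re `|v|.

Section Zmod.
Variable V : normedZmodType R[i].
Implicit Types u v : V.

Lemma rnormE v : `|v| = (rnorm v)%:C.
Proof. by rewrite RRe_real // normr_real. Qed.

Lemma rnorm_ge0 v : 0 <= rnorm v.
Proof. by rewrite -ler0c -rnormE. Qed.

Lemma ler_rnormD u v : rnorm (u + v) <= rnorm u + rnorm v.
Proof. by rewrite -lecR rmorphD /= -!rnormE ler_normD. Qed.

Lemma rnormN v : rnorm (- v) = rnorm v.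
Proof. by rewrite /rnorm normrN. Qed.

Lemma rnorm_distC u v : rnorm (u - v) = rnorm (v - u).
Proof. by rewrite -rnormN opprB. Qed.

Lemma rnorm0 : rnorm (0 : V) = 0.
Proof. by rewrite /rnorm normr0. Qed.

Lemma rnorm0_eq0 v : rnorm v = 0 -> v = 0.
Proof. by move=> v0; apply/eqP; rewrite -normr_eq0 rnormE v0. Qed.

Lemma rnorm_le_eps v : (forall e, 0 < e -> rnorm v <= e) -> v = 0.
Proof.
move=> h; apply: rnorm0_eq0; apply/eqP; rewrite eq_le rnorm_ge0 andbT.
by apply/ler_addgt0Pr => e /h; rewrite add0r.
Qed.

Lemma ler_rnorm_sum (X : Type) (r : seq X) (f : X -> V) :
  rnorm (\sum_(x <- r) f x) <= \sum_(x <- r) rnorm (f x).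
Proof.
elim/big_ind2: _ => [|a b c d ab cd|//]; first by rewrite rnorm0.
exact: le_trans (ler_rnormD _ _) (lerD ab cd).
Qed.

End Zmod.

Lemma rnormZ (V : normedModType R[i]) (a : R[i]) (v : V) :
  rnorm (a *: v) = rnorm a * rnorm v.
Proof. by apply/complexI; rewrite rmorphM /= -!rnormE normrZ. Qed.

Lemma rnormM (a b : R[i]) : rnorm (a * b) = rnorm a * rnorm b.
Proof. by apply/complexI; rewrite rmorphM /= -!rnormE normrM. Qed.

Lemma rnorm_real (x : R) : rnorm (x%:C) = `|x|.
Proof. by rewrite /rnorm normc_def /= expr0n /= addr0 sqrtr_sqr. Qed.

Lemma rnorm_conj (a : R[i]) : rnorm (Num.conj a) = rnorm a.
Proof. by rewrite /rnorm norm_conjC. Qed.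

Lemma ler_Re_rnorm (a : R[i]) : `|complex.Re a| <= rnorm a.
Proof. by rewrite -lecR -rnormE normc_ge_Re. Qed.

Lemma ler_Im_rnorm (a : R[i]) : `|complex.Im a| <= rnorm a.
Proof.
rewrite -lecR -rnormE.
have -> : complex.Im a = complex.Re (- 'i * a).
  by case: a => x y /=; rewrite oppr0; ring.
rewrite (le_trans (normc_ge_Re _)) // normrM normrN.
by rewrite normc_def /= expr0n expr1n add0r sqrtr1 mul1r.
Qed.

Lemma ler_rnorm_ReIm (a : R[i]) :
  rnorm a <= `|complex.Re a| + `|complex.Im a|.
Proof.
rewrite {1}[a]complexE (le_trans (ler_rnormD _ _)) // rnormM !rnorm_real.
by rewrite {1}/rnorm normc_def /= expr0n expr1n add0r sqrtr1 mul1r.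
Qed.

End RealNorm.

#[local] Existing Instance totally_filter.

Section Sums.
Variables (R : realType) (X : choiceType).
Implicit Types (A B : {fset X}) (a : X -> R).

Lemma esum_lefP a (M : R) : (forall x, 0 <= a x) ->
  (\esum_(x in [set: X]) (a x)%:E <= M%:E)%E <->
  forall A, \sum_(x <- A) a x <= M.
Proof.
move=> a0; split=> [le A|h].
  rewrite -lee_fin -sumEFin; apply: le_trans le; apply: esum_ge.
  exists [set` A]; first by split.
  by rewrite fsbig_finite //= set_fsetK.
apply: ge_ereal_sup => _ [Y [Yf _] <-].
by rewrite fsbig_finite //= sumEFin lee_fin.
Qed.

Lemma esum_fineK a : (forall x, 0 <= a x) ->
  (\esum_(x in [set: X]) (a x)%:E < +oo)%E ->
  (fine (\esum_(x in [set: X]) (a x)%:E))%:E = (\esum_(x in [set: X]) (a x)%:E)%E.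
Proof.
move=> a0 lt; rewrite fineK // ge0_fin_numE //.
by apply: esum_ge0 => x _; rewrite lee_fin.
Qed.

Lemma esum_fset_le a A : (forall x, 0 <= a x) ->
  (\esum_(x in [set: X]) (a x)%:E < +oo)%E ->
  \sum_(x <- A) a x <= fine (\esum_(x in [set: X]) (a x)%:E).
Proof.
by move=> a0 lt; apply: (esum_lefP _ a0).1; rewrite esum_fineK.
Qed.

Lemma esum_fine_le a (M : R) : (forall x, 0 <= a x) ->
  (forall A, \sum_(x <- A) a x <= M) ->
  fine (\esum_(x in [set: X]) (a x)%:E) <= M.
Proof.
move=> a0 h; have le := (esum_lefP _ a0).2 h.
by rewrite -lee_fin esum_fineK // (le_lt_trans le) ?ltry.
Qed.

Lemma esum_lty a (M : R) : (forall x, 0 <= a x) ->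
  (forall A, \sum_(x <- A) a x <= M) ->
  (\esum_(x in [set: X]) (a x)%:E < +oo)%E.
Proof. by move=> a0 h; rewrite (le_lt_trans ((esum_lefP _ a0).2 h)) ?ltry. Qed.

Lemma sum_fsetU_disj (V : nmodType) (f : X -> V) A B :
  (A `<=` B)%fset ->
  \sum_(x <- B) f x = \sum_(x <- A) f x + \sum_(x <- (B `\` A)%fset) f x.
Proof.
move=> AB; rewrite (big_fsetID _ (mem A)) /=; congr (_ + _).
  apply: eq_fbigl => x; rewrite !inE /= andbC.
  by case xA: (x \in A) => //=; rewrite (fsubsetP AB).
by apply: eq_fbigl => x; rewrite !inE /= andbC.
Qed.

(** A finite set whose partial sum is within [e] of the supremum leaves at most [e] to any finite
    set disjoint from it. *)
Lemma esum_tail a (e : R) : (forall x, 0 <= a x) ->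
  (\esum_(x in [set: X]) (a x)%:E < +oo)%E -> 0 < e ->
  exists A, forall B, [disjoint A & B]%fset -> \sum_(x <- B) a x <= e.
Proof.
move=> a0 lt e0; set s := fine (\esum_(x in [set: X]) (a x)%:E).
have [A hA] : exists A, s - e <= \sum_(x <- A) a x.
  apply: contrapT => nA.
  have : s <= s - e.
    by apply: esum_fine_le => // A; rewrite leNgt; apply/negP => /ltW le; apply: nA; exists A.
  by rewrite lerBrDr gerDl leNgt e0.
exists A => B AB; have := @esum_fset_le a (A `|` B)%fset a0 lt.
rewrite -/s (@sum_fsetU_disj _ _ A (A `|` B)%fset) ?fsubsetUl //.
have -> : ((A `|` B) `\` A)%fset = B.
  apply/fsetP => x; rewrite !inE andb_orr andNb /=.
  by case xB: (x \in B); rewrite ?andbF // (fdisjointP_sym AB).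
lra.
Qed.

Variable V : normedModType R[i].
Implicit Types (f g : X -> V) (s t : V).

(** Convergence along the finite subsets ordered by inclusion, with real [e] in place of the complex
    ones of the filter formulation ([has_sum_cvg]). *)
Definition has_sum f s := forall e : R, 0 < e ->
  exists A, forall B, (A `<=` B)%fset -> rnorm (\sum_(x <- B) f x - s) <= e.

Definition abs_summable f :=
  (\esum_(x in [set: X]) (rnorm (f x))%:E < +oo)%E.

Lemma partial_sumE f A : partial_sum f A = \sum_(x <- A) f x.
Proof. by rewrite /partial_sum big_seq_fsetE. Qed.

Lemma has_sum_cvg f s : has_sum f s <-> partial_sum f @ totally --> s.
Proof.
split=> [h|].
  apply/cvgrPdist_le => e e0.
  have e0' : 0 < complex.Re e by move: e0; rewrite ltcE => /andP[].
  have [A hA] := h _ e0'; exists A => // B /= AB.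
  rewrite distrC partial_sumE rnormE -[e]RRe_real ?gtr0_real // lecR.
  exact: hA.
move/cvgrPdist_le => h e e0.
have /h[A _ hA] : 0 < e%:C by rewrite ltcR.
exists A => B AB; have := hA B AB.
by rewrite distrC partial_sumE rnormE lecR.
Qed.

Lemma has_sumE f s : has_sum f s -> summability.sum f = s.
Proof. by move/has_sum_cvg; apply: cvg_lim; apply: norm_hausdorff. Qed.

Lemma has_sum_lin f g s t (c : R[i]) : has_sum f s -> has_sum g t ->
  has_sum (fun x => c *: f x + g x) (c *: s + t).
Proof.
move=> hf hg e e0; pose e1 := e / 2 / (rnorm c + 1).
have c1 : 0 < rnorm c + 1 by rewrite ltr_wpDl ?rnorm_ge0.
have e1_gt0 : 0 < e1 by rewrite !divr_gt0.
have [A hA] := hf _ e1_gt0; have e2 : 0 < e / 2 by rewrite divr_gt0.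
have [B hB] := hg _ e2; exists (A `|` B)%fset => D; rewrite fsubUset => /andP[AD BD].
rewrite big_split /= -scaler_sumr opprD addrACA -scalerBr.
rewrite (le_trans (ler_rnormD _ _)) // [leRHS]splitr lerD ?hB // rnormZ.
have -> : e / 2 = (rnorm c + 1) * e1 by rewrite /e1 [RHS]mulrC divfK // gt_eqF.
by rewrite ler_pM ?rnorm_ge0 ?lerDl ?hA.
Qed.

Lemma has_sum_rnorm_le f s (M : R) : has_sum f s ->
  (forall A, rnorm (\sum_(x <- A) f x) <= M) -> rnorm s <= M.
Proof.
move=> hf h; apply/ler_addgt0Pr => e e0; have [A hA] := hf _ e0.
have -> : s = \sum_(x <- A) f x - (\sum_(x <- A) f x - s) by rewrite subKr.
by rewrite (le_trans (ler_rnormD _ _)) // rnormN lerD ?hA // fsubset_refl.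
Qed.

Lemma has_sum_finite f A : (forall x, x \notin A -> f x = 0) ->
  has_sum f (\sum_(x <- A) f x).
Proof.
move=> f0 e e0; exists A => B AB; rewrite (sum_fsetU_disj _ AB) addrC addKr.
by rewrite big_seq big1 ?rnorm0 ?ltW // => x; rewrite !inE => /andP[/f0].
Qed.

Lemma has_sum_unique f s t : has_sum f s -> has_sum f t -> s = t.
Proof. by move=> /has_sumE <- /has_sumE. Qed.

End Sums.

(** Additivity is asked instead of linearity so that complex conjugation is covered. *)
Lemma has_sum_bounded (R : realType) (X : choiceType) (V W : normedModType R[i])
    (L : V -> W) (M : R) (f : X -> V) s :
  {morph L : u v / u + v} -> L 0 = 0 ->
  (forall v, rnorm (L v) <= M * rnorm v) ->
  has_sum f s -> has_sum (L \o f) (L s).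
Proof.
move=> LD L0 LM hf e e0.
have M1 : 0 < `|M| + 1 by rewrite ltr_wpDl.
have [A hA] := hf _ (divr_gt0 e0 M1); exists A => B /hA le.
have LN v : L (- v) = - L v.
  by apply/eqP; rewrite -addr_eq0 -LD addrC subrr L0.
rewrite /= -(big_morph L LD L0) -LN -LD (le_trans (LM _)) //.
rewrite (@le_trans _ _ ((`|M| + 1) * (e / (`|M| + 1)))) //; last first.
  by rewrite mulrC divfK // gt_eqF.
apply: le_trans (ler_wpM2l (ltW M1) le).
rewrite ler_wpM2r ?rnorm_ge0 // (le_trans (ler_norm _)) // lerDl.
exact: ler01.
Qed.

(* [R[i]^o] has no canonical complete structure: the one of [T^o] is declared
   for real types only.  Hence completeness is a hypothesis here. *)
Definition cauchy_complete (T : puniformType) :=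
  forall F : set_system T, ProperFilter F -> cauchy F -> cvg F.

Section CompleteSums.
Variables (R : realType) (X : choiceType) (V : normedModType R[i]).
Hypothesis complV : cauchy_complete V.
Implicit Types (f g : X -> V).

Lemma abs_summable_has_sum f : abs_summable f -> has_sum f (summability.sum f).
Proof.
move=> sf; apply/has_sum_cvg.
suff : cvg (partial_sum f @ totally) by [].
apply: complV; apply/cauchy_ballP => e e0.
have e0' : 0 < complex.Re e by move: e0; rewrite ltcE => /andP[].
have e2 : 0 < complex.Re e / 3 by rewrite divr_gt0.
have [A hA] := esum_tail (fun x => rnorm_ge0 (f x)) sf e2.
have near B : (A `<=` B)%fset -> rnorm (\sum_(x <- B) f x - \sum_(x <- A) f x) <= complex.Re e / 3.
  move=> AB; rewrite (sum_fsetU_disj _ AB) addrC addKr.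
  rewrite (le_trans (ler_rnorm_sum _ _)) // hA //.
  by apply/fdisjointP => x xA; rewrite inE xA.
exists ([set partial_sum f B | B in [set B | (A `<=` B)%fset]],
        [set partial_sum f B | B in [set B | (A `<=` B)%fset]]).
  by split; exists A => // B AB; exists B.
move=> [_ _] /= [[B AB <-] [B' AB' <-]]; rewrite -ball_normE /=.
rewrite rnormE -[e]RRe_real ?gtr0_real // ltcR !partial_sumE.
rewrite -(subrKA (\sum_(x <- A) f x)).
rewrite (le_lt_trans (ler_rnormD _ _)) //.
have := near _ AB; have := near _ AB'; rewrite rnorm_distC => ? ?.
lra.
Qed.

End CompleteSums.

(** * Closed subspaces of the Hilbert space of square-summable families *)

(** Real and imaginary parts are contractions for [rnorm], so they carry a Cauchy filter to Cauchy
    filters on the complete line [R]; the two limits form the complex limit. *)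
Lemma complex_complete (R : realType) : cauchy_complete R[i]^o.
Proof.
move=> F FF Fc.
have part (p : R[i] -> R) : (forall z w, `|p z - p w| <= rnorm (z - w)) ->
    exists x, forall e : R, 0 < e -> F [set z | `|p z - x| < e].
  move=> hp; have Gc : cauchy (p @ F).
    apply/cauchy_ballP => e e0.
    have Fb : cauchy_ball F by apply/cauchy_ballP.
    have /Fb : 0 < e%:C by rewrite ltcR.
    move=> [[A B] /= [FA FB] AB]; exists (p @` A, p @` B) => /=.
      by split; [apply: filterS FA|apply: filterS FB] => z; exists z.
    move=> [_ _] /= [[z Az <-] [w Bw <-]]; have := AB (z, w) (conj Az Bw).
    by rewrite -!ball_normE /= rnormE ltcR; apply: le_lt_trans.
  have /cvg_ex[x hx] : cvg (p @ F) by exact: cauchy_cvg.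
  exists x => e e0.
  move/cvgrPdist_lt : hx => /(_ _ e0); apply: filterS => z.
  by rewrite /= distrC.
have [z w|x hx] := part (@complex.Re R).
  by rewrite -raddfB ler_Re_rnorm.
have [z w|y hy] := part (@complex.Im R).
  by rewrite -raddfB ler_Im_rnorm.
apply/cvg_ex; exists (x +i* y); apply/cvgrPdist_lt => e e0.
have e0' : 0 < complex.Re e / 2.
  by rewrite divr_gt0 //; move: e0; rewrite ltcE => /andP[].
apply: filterS (filterI (hx _ e0') (hy _ e0')) => z /= [h1 h2].
rewrite distrC rnormE -[e]RRe_real ?gtr0_real // ltcR.
apply: le_lt_trans (ler_rnorm_ReIm _) _.
case: z h1 h2 => a b /= h1 h2; lra.
Qed.

Lemma complex_abs_summable (R : realType) (X : choiceType) (f : X -> R[i]^o) :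
  abs_summable f -> has_sum f (summability.sum f).
Proof. by move=> sf; apply: abs_summable_has_sum sf; exact: complex_complete. Qed.

Section CauchySchwarz.
Variables (R : realType) (X : Type).
Implicit Types (a b : X -> R) (r : seq X).

(** The quadratic [sum (a x - t b x)^2] is nonnegative for every real [t]; at its minimum
    [t = S / B] this is the inequality. *)
Lemma CauchySchwarz_seq a b r :
  (\sum_(x <- r) a x * b x) ^+ 2 <=
  (\sum_(x <- r) a x ^+ 2) * (\sum_(x <- r) b x ^+ 2).
Proof.
set S := \sum_(x <- r) _ * _; set A := \sum_(x <- r) _; set B := \sum_(x <- r) _.
have quad t : 0 <= A - t *+ 2 * S + t ^+ 2 * B.
  suff -> : A - t *+ 2 * S + t ^+ 2 * B = \sum_(x <- r) (a x - t * b x) ^+ 2.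
    by apply: sumr_ge0 => x _; rewrite sqr_ge0.
  rewrite /A /S /B !mulr_sumr -sumrN -!big_split /=.
  by apply: eq_bigr => x _; ring.
have B0 : 0 <= B by apply: sumr_ge0 => x _; rewrite sqr_ge0.
have [B00|Bn0] := eqVneq B 0.
  have [->|Sn0] := eqVneq S 0; first by rewrite expr0n B00 mulr0.
  (* With [B = 0] the quadratic is affine in [t], and this [t] gives it the value [-1]. *)
  have := quad ((A + 1) / (S *+ 2)); rewrite B00 mulr0 addr0.
  have -> : ((A + 1) / (S *+ 2)) *+ 2 * S = A + 1.
    by field; rewrite Sn0.
  by rewrite opprD addrA subrr; lra.
have Bp : 0 < B by rewrite lt_def Bn0.
have := quad (S / B).
have -> : A - (S / B) *+ 2 * S + (S / B) ^+ 2 * B = A - S ^+ 2 / B by field.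
by rewrite subr_ge0 ler_pdivrMr.
Qed.

Lemma Minkowski_seq a b r (s t : R) : 0 <= s -> 0 <= t ->
  \sum_(x <- r) a x ^+ 2 <= s ^+ 2 -> \sum_(x <- r) b x ^+ 2 <= t ^+ 2 ->
  \sum_(x <- r) (a x + b x) ^+ 2 <= (s + t) ^+ 2.
Proof.
move=> s0 t0 ha hb.
have CS : \sum_(x <- r) a x * b x <= s * t.
  rewrite leNgt; apply/negP => lt.
  have st0 : 0 <= s * t by rewrite mulr_ge0.
  have := CauchySchwarz_seq a b r; rewrite leNgt => /negP; apply.
  rewrite (@le_lt_trans _ _ ((s * t) ^+ 2)) //.
    rewrite exprMn ler_pM // ?sumr_ge0 // => x _; exact: sqr_ge0.
  by rewrite ltr_pXn2r ?nnegrE // (le_trans st0) // ltW.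
have -> : \sum_(x <- r) (a x + b x) ^+ 2 =
    \sum_(x <- r) a x ^+ 2 + 2 * (\sum_(x <- r) a x * b x)
    + \sum_(x <- r) b x ^+ 2.
  by rewrite mulr_sumr -!big_split /=; apply: eq_bigr => x _; ring.
have -> : (s + t) ^+ 2 = s ^+ 2 + 2 * (s * t) + t ^+ 2 by ring.
lra.
Qed.

End CauchySchwarz.

Section SquareSummable.
Variables (R : realType) (I : choiceType).
Implicit Types (f g : I -> R[i]^o).

Definition l2 : set (I -> R[i]^o) :=
  [set f | (\esum_(i in [set: I]) (rnorm (f i) ^+ 2)%:E < +oo)%E].

Definition l2_sq f : R := fine (\esum_(i in [set: I]) (rnorm (f i) ^+ 2)%:E).

Definition l2_norm f : R := Num.sqrt (l2_sq f).

Let sq0 f i : 0 <= rnorm (f i) ^+ 2. Proof. exact: sqr_ge0. Qed.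

Lemma l2_sq_ge0 f : 0 <= l2_sq f.
Proof. by apply: fine_ge0; apply: esum_ge0 => i _; rewrite lee_fin. Qed.

Lemma l2_norm_ge0 f : 0 <= l2_norm f.
Proof. exact: sqrtr_ge0. Qed.

Lemma sqr_l2_norm f : l2_norm f ^+ 2 = l2_sq f.
Proof. by rewrite sqr_sqrtr // l2_sq_ge0. Qed.

Lemma l2_sum_le f (A : {fset I}) : l2 f ->
  \sum_(i <- A) rnorm (f i) ^+ 2 <= l2_sq f.
Proof. exact: esum_fset_le. Qed.

Lemma l2P f (M : R) :
  (forall A : {fset I}, \sum_(i <- A) rnorm (f i) ^+ 2 <= M) ->
  l2 f /\ l2_sq f <= M.
Proof. by move=> h; split; [exact: esum_lty h|exact: esum_fine_le]. Qed.

Lemma l2_coord f i : l2 f -> rnorm (f i) <= l2_norm f.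
Proof.
move=> f2; rewrite -(@ler_pXn2r _ 2) ?nnegrE ?rnorm_ge0 ?l2_norm_ge0 //.
by have := l2_sum_le [fset i]%fset f2; rewrite big_seq_fset1 sqr_l2_norm.
Qed.

Lemma l2_normP f (s : R) : 0 <= s ->
  (forall A : {fset I}, \sum_(i <- A) rnorm (f i) ^+ 2 <= s ^+ 2) ->
  l2 f /\ l2_norm f <= s.
Proof.
move=> s0 /l2P[f2 le]; split=> //.
by rewrite -(@ler_pXn2r _ 2) ?nnegrE ?l2_norm_ge0 // sqr_l2_norm.
Qed.

Lemma l2_normD f g : l2 f -> l2 g -> l2 (f + g) /\ l2_norm (f + g) <= l2_norm f + l2_norm g.
Proof.
move=> f2 g2; apply: l2_normP => [|A]; first by rewrite addr_ge0 ?l2_norm_ge0.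
have := @Minkowski_seq _ _ (fun i => rnorm (f i)) (fun i => rnorm (g i)) A _ _
  (l2_norm_ge0 f) (l2_norm_ge0 g).
rewrite !sqr_l2_norm !l2_sum_le // => /(_ isT isT); apply: le_trans.
apply: ler_sum => i _.
rewrite ler_pXn2r ?nnegrE ?addr_ge0 ?rnorm_ge0 //; exact: ler_rnormD.
Qed.

Lemma l2_normZ (a : R[i]) f : l2 f ->
  l2 (a *: f) /\ l2_norm (a *: f) <= rnorm a * l2_norm f.
Proof.
move=> f2; apply: l2_normP => [|A].
  by rewrite mulr_ge0 ?rnorm_ge0 ?l2_norm_ge0.
rewrite exprMn sqr_l2_norm (le_trans _ (ler_wpM2l (sqr_ge0 _) (l2_sum_le A f2))) //.
by rewrite mulr_sumr ler_sum // => i _; rewrite rnormM exprMn.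
Qed.

Lemma l2_0 : l2 0 /\ l2_norm 0 = 0.
Proof.
have [] : l2 0 /\ l2_norm 0 <= 0.
  apply: l2_normP => // A.
  by rewrite big1 ?expr0n // => i _; rewrite rnorm0 expr0n.
by split=> //; apply/eqP; rewrite eq_le l2_norm_ge0 andbT.
Qed.

Lemma l2_normZE (a : R[i]) f : l2 f -> l2_norm (a *: f) = rnorm a * l2_norm f.
Proof.
move=> f2; have [->|a0] := eqVneq a 0.
  by rewrite scale0r l2_0.2 rnorm0 mul0r.
apply/eqP; rewrite eq_le (l2_normZ a f2).2 /=.
have af2 := (l2_normZ a f2).1; have := (l2_normZ a^-1 af2).2.
rewrite scalerA mulVf // scale1r => le.
have : rnorm a * l2_norm f <= rnorm a * (rnorm a^-1 * l2_norm (a *: f)).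
  by rewrite ler_wpM2l ?rnorm_ge0.
rewrite mulrA -rnormM mulfV //.
have -> : rnorm (1 : R[i]) = 1 by rewrite /rnorm normr1.
by rewrite mul1r.
Qed.

Lemma l2_norm0_eq0 f : l2 f -> l2_norm f = 0 -> f = 0.
Proof.
move=> f2 f0; apply/funext => i; apply: rnorm0_eq0; apply/eqP.
by rewrite eq_le rnorm_ge0 andbT -f0 l2_coord.
Qed.

Definition l2_inner f g : R[i] :=
  summability.sum (fun i => f i * Num.conj (g i) : R[i]^o).

Lemma l2_inner_summable f g : l2 f -> l2 g ->
  abs_summable (fun i => f i * Num.conj (g i) : R[i]^o).
Proof.
move=> f2 g2; apply: (@esum_lty _ _ _ (l2_sq f + l2_sq g)) => [i|A].
  exact: rnorm_ge0.
apply: le_trans (lerD (l2_sum_le A f2) (l2_sum_le A g2)).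
rewrite -big_split ler_sum //= => i _.
rewrite [X in X <= _](rnormM (f i) (Num.conj (g i))) rnorm_conj.
have := sqr_ge0 (rnorm (f i) - rnorm (g i)).
have := mulr_ge0 (rnorm_ge0 (f i)) (rnorm_ge0 (g i)).
rewrite sqrrB; lra.
Qed.

Lemma l2_inner_linl (a : R[i]) f g h : l2 f -> l2 g -> l2 h ->
  l2_inner (a *: f + g) h = a * l2_inner f h + l2_inner g h.
Proof.
move=> f2 g2 h2.
have E := has_sum_lin a (complex_abs_summable (l2_inner_summable f2 h2))
  (complex_abs_summable (l2_inner_summable g2 h2)).
rewrite /l2_inner.
have -> : (fun i => (a *: f + g) i * Num.conj (h i) : R[i]^o) =
    (fun i => a *: (f i * Num.conj (h i) : R[i]^o) + g i * Num.conj (h i)).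
  by apply/funext => i; rewrite mulrDl -scalerAl.
exact: has_sumE E.
Qed.

Lemma l2_innerC f g : l2 f -> l2 g -> l2_inner f g = Num.conj (l2_inner g f).
Proof.
move=> f2 g2; pose L : R[i]^o -> R[i]^o := @Num.conj R[i].
suff E : has_sum (L \o (fun i => g i * Num.conj (f i) : R[i]^o)) (L (l2_inner g f)).
  rewrite -[RHS](has_sumE E) /l2_inner; apply: f_equal.
  by apply/funext => i; rewrite /= /L rmorphM /= conjCK mulrC.
apply: (@has_sum_bounded _ _ _ _ L 1).
- by move=> u v; rewrite /L rmorphD.
- by rewrite /L rmorph0.
- by move=> v; rewrite mul1r rnorm_conj.
- exact: complex_abs_summable (l2_inner_summable g2 f2).
Qed.

Lemma l2_inner_norm f : l2 f -> l2_inner f f = (l2_norm f ^+ 2)%:C.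
Proof.
move=> f2; rewrite sqr_l2_norm.
suff E : has_sum (fun i => f i * Num.conj (f i) : R[i]^o) ((l2_sq f)%:C : R[i]^o).
  exact: has_sumE E.
move=> e e0.
have [A hA] := esum_tail (sq0 f) f2 e0; exists A => B AB.
have -> : \sum_(i <- B) (f i * Num.conj (f i) : R[i]^o) =
    (\sum_(i <- B) rnorm (f i) ^+ 2)%:C.
  rewrite raddf_sum; apply: eq_bigr => i _ /=.
  by rewrite rmorphXn /= -rnormE -normCK.
rewrite -rmorphB rnorm_real distrC ger0_norm ?subr_ge0 ?l2_sum_le //.
rewrite lerBlDr; apply: esum_fine_le => // D.
rewrite (@le_trans _ _ (\sum_(i <- (B `|` D)%fset) rnorm (f i) ^+ 2)) //.
  rewrite (@sum_fsetU_disj _ _ _ D (B `|` D)%fset) ?fsubsetUr //.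
  by rewrite lerDl sumr_ge0.
rewrite (@sum_fsetU_disj _ _ _ B (B `|` D)%fset) ?fsubsetUl // addrC lerD2r.
apply: hA; apply/fdisjointP => x xA; rewrite !inE.
by rewrite (fsubsetP AB _ xA).
Qed.

(** Functionals are maps on all families, constrained on [l2] only, so that they compose with
    operators of the same kind without a subtype. *)
Definition l2_functional (lam : (I -> R[i]^o) -> R[i]) :=
  (forall (a : R[i]) f g, l2 f -> l2 g ->
     lam (a *: f + g) = a * lam f + lam g) /\
  exists M : R, forall f, l2 f -> rnorm (lam f) <= M * l2_norm f.

Variable D : set (I -> R[i]^o).

(* The double annihilator of [D], that is, the closed linear span of [D] when
   [D] is a set of square-summable families. *)
Definition l2_span : set (I -> R[i]^o) := [set f | l2 f /\
  forall lam, l2_functional lam -> (forall d, D d -> lam d = 0) -> lam f = 0].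

Lemma l2_span_lin (a : R[i]) f g :
  l2_span f -> l2_span g -> l2_span (a *: f + g).
Proof.
move=> [f2 hf] [g2 hg]; split.
  by apply: (l2_normD _ _).1 => //; apply: (l2_normZ _ _).1.
by move=> lam ll lD; rewrite ll.1 // hf // hg // mulr0 addr0.
Qed.

Lemma l2_span0 : l2_span 0.
Proof.
split; first exact: l2_0.1.
move=> lam [ll _] _; have := ll 1 0 0 l2_0.1 l2_0.1.
rewrite scaler0 addr0 mul1r => /eqP.
by rewrite -subr_eq subrr eq_sym => /eqP.
Qed.

Definition l2_span_pred : {pred I -> R[i]^o} := [pred f | `[< l2_span f >]].

Lemma l2_span_closed : GRing.submod_closed l2_span_pred.
Proof.
split; first by apply/asboolP/l2_span0.
by move=> a f g /asboolP hf /asboolP hg; apply/asboolP/l2_span_lin.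
Qed.

HB.instance Definition _ :=
  GRing.isSubmodClosed.Build R[i] (I -> R[i]^o) l2_span_pred l2_span_closed.

Definition span_space := {f : I -> R[i]^o | f \in l2_span_pred}.

HB.instance Definition _ := SubChoice.on span_space.
HB.instance Definition _ := [SubChoice_isSubLmodule of span_space by <:].

Lemma span_spaceP (u : span_space) : l2_span (val u).
Proof. by apply/asboolP; exact: (valP u). Qed.

Lemma span_spaceP2 (u : span_space) : l2 (val u).
Proof. by case: (span_spaceP u). Qed.

Definition span_norm (u : span_space) : R[i] := (l2_norm (val u))%:C.

Lemma span_normD u v : span_norm (u + v) <= span_norm u + span_norm v.
Proof.
by rewrite -rmorphD lecR raddfD (l2_normD _ _).2 //; apply: span_spaceP2.
Qed.

Lemma span_normZ (a : R[i]) u : span_norm (a *: u) = `|a| * span_norm u.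
Proof.
by rewrite rnormE -rmorphM /span_norm linearZ l2_normZE //; apply: span_spaceP2.
Qed.

Lemma span_norm0_eq0 u : span_norm u = 0 -> u = 0.
Proof.
move=> /complexI u0; apply: val_inj.
exact: l2_norm0_eq0 (span_spaceP2 u) u0.
Qed.

HB.instance Definition _ := Lmodule_isNormed.Build R[i] span_space
  span_normD span_normZ span_norm0_eq0.


Lemma span_rnormE (u : span_space) : rnorm u = l2_norm (val u).
Proof. by []. Qed.

Lemma near_fset (T : Type) (F : set_system T) (P : I -> set T) (A : {fset I}) :
  Filter F -> (forall i, F (P i)) -> F [set v | forall i, i \in A -> P i v].
Proof.
move=> FF h.
have -> : [set v | forall i, i \in A -> P i v] =
          [set v | forall i, i \in enum_fset A -> P i v] by [].
elim: (enum_fset A) => [|i r IH]; first by apply: filterS filterT.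
apply: filterS (filterI (h i) IH) => v [Pi Pr] j.
by rewrite inE => /predU1P[->//|/Pr].
Qed.

(** The limit [s] is taken coordinate by coordinate. For [u] and [v] close in norm, [v] may be
    replaced by [s] on a finite set [A] at an arbitrarily small cost, and Minkowski bounds [u - s]
    on [A]. The limit lies in the span because annihilating functionals are continuous. *)
Lemma span_complete : cauchy_complete span_space.
Proof.
move=> F FF Fc.
have Fb : cauchy_ball F by apply/cauchy_ballP.
have coordc i : exists z : R[i]^o, forall e : R, 0 < e ->
    F [set u | rnorm (val u i - z) < e].
  have Gc : cauchy ((fun u : span_space => val u i : R[i]^o) @ F).
    apply/cauchy_ballP => e /Fb[[P Q] /= [FP FQ] PQ].
    exists ((fun u : span_space => val u i) @` P, (fun u : span_space => val u i) @` Q).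
      by split; [apply: filterS FP|apply: filterS FQ] => u; exists u.
    move=> [_ _] /= [[u Pu <-] [v Qv <-]]; have := PQ (u, v) (conj Pu Qv).
    rewrite -!ball_normE /= !rnormE; apply: le_lt_trans.
    by rewrite lecR span_rnormE raddfB; apply: (l2_coord i (span_spaceP2 (u - v))).
  have [z hz] : exists z : R[i]^o, (fun u : span_space => val u i : R[i]^o) @ F --> z.
    by apply/cvg_ex; exact: complex_complete.
  exists z => e e0.
  have e0' : 0 < e%:C by rewrite ltcR.
  move/cvgrPdist_lt : hz => /(_ _ e0'); apply: filterS => u.
  by rewrite /= distrC rnormE ltcR.
pose s i := sval (cid (coordc i)).
have hs i : forall e : R, 0 < e -> F [set u | rnorm (val u i - s i) < e].
  exact: (svalP (cid (coordc i))).
have near_s (e : R) : 0 < e ->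
    exists2 P, F P & forall u, P u -> l2 (val u - s) /\ l2_norm (val u - s) <= e.
  move=> e0; have e0' : 0 < e%:C by rewrite ltcR.
  have [[P Q] /= [FP FQ] PQ] := Fb _ e0'; exists P => // u Pu.
  apply: l2_normP => [|A]; first exact: ltW.
  apply/ler_addgt0Pr => d d0.
  suff [t t0 ht] : exists2 t : R, 0 < t &
      \sum_(i <- A) rnorm ((val u - s) i) ^+ 2 <= (e + t) ^+ 2 /\
      (e + t) ^+ 2 <= e ^+ 2 + d.
    by case: ht => /le_trans; apply.
  (* Since [t <= 1], [(e + t)^2 <= e^2 + t (2 e + 1) <= e^2 + d]. *)
  pose t := Num.min 1 (d / (2 * e + 1)).
  have e21 : 0 < 2 * e + 1 by rewrite addr_gt0 ?mulr_gt0.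
  have t0 : 0 < t by rewrite lt_min ltr01 divr_gt0.
  exists t => //; split; last first.
    have t1 : t <= 1 by rewrite ge_min lexx.
    have : t * (2 * e + 1) <= d.
      by rewrite -ler_pdivlMr // ge_min lexx orbT.
    have : t * t <= t by rewrite ger_pMr.
    rewrite sqrrD expr2; nra.
  (* If the coordinates on [A] are within [t / n] of the limit, the square sum is at most
     [size A * (t / n)^2 <= t^2]. *)
  pose n := (size A)%:R + 1 : R.
  have n0 : 0 < n by rewrite ltr_wpDl ?ler0n.
  have tn : 0 < t / n by rewrite divr_gt0.
  have FA : F [set v | forall i, i \in A -> rnorm (val v i - s i) < t / n].
    by apply: near_fset => i; exact: hs.
  have [v [Qv hv]] := filter_ex (filterI FQ FA).
  have := @Minkowski_seq _ _ (fun i => rnorm ((val u - val v) i))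
    (fun i => rnorm ((val v - s) i)) A e t (ltW e0) (ltW t0).
  have uv2 := span_spaceP2 (u - v); rewrite raddfB in uv2.
  have := PQ (u, v) (conj Pu Qv).
  rewrite -ball_normE /= rnormE ltcR span_rnormE raddfB => uvlt.
  have h1 : \sum_(i <- A) rnorm ((val u - val v) i) ^+ 2 <= e ^+ 2.
    rewrite (le_trans (l2_sum_le A uv2)) // -sqr_l2_norm.
    by rewrite ler_pXn2r ?nnegrE ?l2_norm_ge0 // ltW.
  have h2 : \sum_(i <- A) rnorm ((val v - s) i) ^+ 2 <= t ^+ 2.
    rewrite (@le_trans _ _ (\sum_(i <- A) (t / n) ^+ 2)) //.
      rewrite big_seq [leRHS]big_seq ler_sum // => i iA.
      by rewrite ler_pXn2r ?nnegrE ?rnorm_ge0 ?ltW //; apply: hv.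
    rewrite big_const_seq count_predT iter_addr_0 -mulr_natl exprMn.
    rewrite mulrCA -[leRHS]mulr1 ler_wpM2l ?sqr_ge0 // exprVn.
    rewrite ler_pdivrMr ?exprn_gt0 // mul1r /n sqrrD.
    have := ler0n R (size A); nra.
  move=> /(_ h1 h2); apply: le_trans; apply: ler_sum => i _.
  rewrite ler_pXn2r ?nnegrE ?addr_ge0 ?rnorm_ge0 //.
  by rewrite -[in leLHS](subrKA (val v)) ler_rnormD.
have s_span : l2_span s.
  have [P FP hP] := near_s _ ltr01; have [u Pu] := filter_ex FP.
  have [us2 _] := hP _ Pu; have s2 : l2 s.
    rewrite -[s](subKr (val u)) -scaleN1r.
    exact: (l2_normD (span_spaceP2 u) (l2_normZ _ us2).1).1.
  split=> // lam ll lD; have [M hM] := ll.2; apply: rnorm_le_eps => e e0.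
  have M1 : 0 < `|M| + 1 by rewrite ltr_wpDl.
  have [Q FQ hQ] := near_s _ (divr_gt0 e0 M1).
  have [v Qv] := filter_ex FQ; have [vs2 vsle] := hQ _ Qv.
  have -> : lam s = - lam (val v - s).
    have lv : lam (val v) = 0 by apply: (span_spaceP v).2.
    transitivity (lam ((-1) *: (val v - s) + val v)).
      by rewrite scaleN1r opprB subrK.
    by rewrite ll.1 //; [rewrite mulN1r lv addr0|exact: span_spaceP2].
  rewrite rnormN (le_trans (hM _ vs2)) //.
  rewrite (@le_trans _ _ ((`|M| + 1) * (e / (`|M| + 1)))) //.
    apply: le_trans (ler_wpM2l (ltW M1) vsle).
    by rewrite ler_wpM2r ?l2_norm_ge0 // (le_trans (ler_norm _)) // lerDl.
  by rewrite mulrC divfK // gt_eqF.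
apply/cvg_ex; exists (Sub s (introT (asboolP _) s_span) : span_space).
apply/cvgrPdist_le => e e0.
have e0' : 0 < complex.Re e by move: e0; rewrite ltcE => /andP[].
have [P FP hP] := near_s _ e0'; apply: filterS FP => u /hP[_ le].
rewrite distrC rnormE -[e]RRe_real ?gtr0_real // lecR span_rnormE.
by rewrite raddfB.
Qed.

HB.instance Definition _ := Uniform_isComplete.Build span_space span_complete.

Definition span_inner (u v : span_space) : R[i] := l2_inner (val u) (val v).

Lemma span_inner_linl (a : R[i]) u v w :
  span_inner (a *: u + v) w = a * span_inner u w + span_inner v w.
Proof. by rewrite /span_inner linearP l2_inner_linl //; apply: span_spaceP2. Qed.

Lemma span_innerC u v : span_inner u v = Num.conj (span_inner v u).
Proof. by apply: l2_innerC; apply: span_spaceP2. Qed.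

Lemma span_inner_norm (u : span_space) : `|u| ^+ 2 = span_inner u u.
Proof.
by rewrite /span_inner l2_inner_norm ?rmorphXn //; apply: span_spaceP2.
Qed.

Lemma span_inner_bilinear :
  bilinear_for (GRing.Scale.Law.clone _ _ *%R _)
    (GRing.Scale.Law.clone _ _ (@Num.conj R[i] \; *%R) _) span_inner.
Proof.
split=> w a u v /=; first exact: span_inner_linl.
by rewrite span_innerC span_inner_linl rmorphD rmorphM /= -!span_innerC.
Qed.

HB.instance Definition _ := bilinear_isBilinear.Build R[i] span_space span_space
  R[i] _ _ span_inner span_inner_bilinear.

Lemma span_inner_hermitian u v :
  span_inner u v = (-1) ^+ false * Num.conj (span_inner v u).
Proof. by rewrite expr0 mul1r span_innerC. Qed.

HB.instance Definition _ := isHermitianSesquilinear.Build R[i] span_space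
  false (@Num.conj R[i]) span_inner span_inner_hermitian.

Lemma span_inner_gt0 u : u != 0 -> 0 < span_inner u u.
Proof. by move=> u0; rewrite -span_inner_norm exprn_gt0 // normr_gt0. Qed.

HB.instance Definition _ := isDotProduct.Build R[i] span_space span_inner
  span_inner_gt0.

Definition span_hilbert : hilbertSpace R :=
  @HilbertSpace R (span_space : completeNormedModType R[i])
    (span_inner : {dot span_space for (@Num.conj R[i])}) span_inner_norm.

End SquareSummable.

(** * Bounded operators and weighted group algebras *)

Section OperatorNorm.
Variables (R : realType) (H : hilbertSpace R).
Implicit Types (S T : H -> H) (u v : H).

Lemma bounded_operator_ge0 T : bounded_operator T ->
  exists2 M : R, 0 <= M & forall u, rnorm (T u) <= M * rnorm u.
Proof.
move=> [_ [M hM]]; exists `|M| => // u; apply: le_trans (hM u) _.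
by rewrite ler_wpM2r ?rnorm_ge0 // ler_norm.
Qed.

Lemma opnorm_le T (M : R) : 0 <= M ->
  (forall u, rnorm (T u) <= M * rnorm u) -> opnorm T <= M.
Proof.
move=> M0 hM; apply: ge_sup.
  by exists (rnorm (T 0)), 0 => //=; rewrite /hnorm -/(rnorm _) rnorm0.
move=> _ [u /= u1 <-]; apply: le_trans (hM u) _.
by rewrite -[leRHS]mulr1 ler_wpM2l.
Qed.

Lemma bounded_operator0 T : bounded_operator T -> T 0 = 0.
Proof.
move=> [lT _]; have := lT 1 0 0; rewrite !scale1r addr0 => /eqP.
by rewrite -subr_eq subrr eq_sym => /eqP.
Qed.

Lemma bounded_operatorZ T a u : bounded_operator T -> T (a *: u) = a *: T u.
Proof.
by move=> bT; have := bT.1 a u 0; rewrite !addr0 (bounded_operator0 bT) addr0.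
Qed.

Lemma le_opnorm_unit T u : bounded_operator T -> rnorm u <= 1 ->
  rnorm (T u) <= opnorm T.
Proof.
move=> /bounded_operator_ge0[M M0 hM] u1; apply: ub_le_sup; last by exists u.
exists M => _ [v /= v1 <-]; apply: le_trans (hM v) _.
by rewrite -[leRHS]mulr1 ler_wpM2l.
Qed.

Lemma opnorm_ge0 T : bounded_operator T -> 0 <= opnorm T.
Proof.
move=> bT; apply: le_trans (le_opnorm_unit (u := 0) bT _); first exact: rnorm_ge0.
by rewrite rnorm0.
Qed.

Lemma le_opnorm T u : bounded_operator T -> rnorm (T u) <= opnorm T * rnorm u.
Proof.
move=> bT; have [->|u0] := eqVneq u 0.
  by rewrite (bounded_operator0 bT) !rnorm0 mulr0.
have nu0 : 0 < rnorm u.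
  by rewrite lt_def rnorm_ge0 andbT; apply: contra_neq u0 => /rnorm0_eq0.
have := @le_opnorm_unit T ((rnorm u)^-1%:C *: u) bT.
rewrite (bounded_operatorZ _ _ bT) !rnormZ rnorm_real ger0_norm; last first.
  by rewrite invr_ge0 ltW.
by rewrite mulVf ?gt_eqF // lexx => /(_ isT); rewrite ler_pdivrMl // mulrC.
Qed.

Lemma bounded_operator_lin a S T : bounded_operator S -> bounded_operator T ->
  bounded_operator (a *: S + T).
Proof.
move=> bS bT; split.
  move=> c u v; rewrite -[LHS]/(a *: S _ + T _) bS.1 bT.1.
  rewrite !scalerDr addrACA; congr (_ + _ + _).
  by rewrite !scalerA mulrC.
exists (rnorm a * opnorm S + opnorm T) => u; apply: le_trans (ler_rnormD _ _) _.
by rewrite mulrDl lerD ?le_opnorm // rnormZ -mulrA ler_wpM2l ?rnorm_ge0 ?le_opnorm.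
Qed.

Lemma bounded_operatorB S T : bounded_operator S -> bounded_operator T ->
  bounded_operator (S - T).
Proof.
by move=> bS bT; rewrite addrC -scaleN1r; apply: bounded_operator_lin.
Qed.

Lemma opnormD_le S T : bounded_operator S -> bounded_operator T ->
  opnorm (S - T) <= opnorm S + opnorm T.
Proof.
move=> bS bT; apply: opnorm_le => [|u]; first by rewrite addr_ge0 ?opnorm_ge0.
by rewrite (le_trans (ler_rnormD _ _)) // rnormN mulrDl lerD ?le_opnorm.
Qed.

Lemma opnorm_distC S T : opnorm (S - T) = opnorm (T - S).
Proof.
congr sup; apply: eq_imagel => u _.
by rewrite /hnorm -!/(rnorm _); apply: (rnorm_distC (S u) (T u)).
Qed.

Lemma opnorm_sub_trans S T U : bounded_operator S -> bounded_operator T ->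
  bounded_operator U -> opnorm (S - U) <= opnorm (S - T) + opnorm (T - U).
Proof.
move=> bS bT bU.
have -> : S - U = (S - T) - (U - T) by rewrite opprB addrA subrK.
by rewrite [in leRHS](opnorm_distC T) opnormD_le //; apply: bounded_operatorB.
Qed.

End OperatorNorm.

Lemma sum_fset_inj_le (R : numDomainType) (X Y : choiceType) (e : X -> Y)
    (a : Y -> R) (M : R) (A : {fset X}) : injective e ->
  (forall B : {fset Y}, \sum_(y <- B) a y <= M) -> \sum_(x <- A) a (e x) <= M.
Proof.
move=> ei h; apply: le_trans (h [fset e x | x in A]%fset).
by rewrite big_imfset //= => x y _ _ /ei.
Qed.

Lemma sum_single (R : numDomainType) (X : choiceType) (A : {fset X})
    (a : X -> R) x : (forall y, 0 <= a y) ->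
  (forall y, y != x -> a y = 0) -> \sum_(y <- A) a y <= a x.
Proof.
move=> a0 ax; have [xA|xA] := boolP (x \in A).
  by rewrite (big_fsetD1 x) //= big_seq big1 ?addr0 // => y; rewrite !inE => /andP[/ax].
by rewrite big_seq big1 // => y yA; rewrite ax //; apply: contraNneq xA => <-.
Qed.

(** * The weighted l^1 space and its convolution *)

Section L1.
Variables (R : realType) (G : groupType) (w : G -> R).
Hypothesis w_gt0 : forall x, 0 < w x.
Implicit Types (f g : G -> R[i]^o) (A B : {fset G}).

Let w_ge0 x : 0 <= w x. Proof. exact: ltW. Qed.

Let term_ge0 f x : 0 <= rnorm (f x) * w x.
Proof. by rewrite mulr_ge0 ?rnorm_ge0. Qed.

Lemma l1_fset_le f A : l1 w f -> \sum_(x <- A) rnorm (f x) * w x <= l1_norm w f.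
Proof. exact: esum_fset_le (term_ge0 f). Qed.

Lemma l1P f (M : R) : (forall A, \sum_(x <- A) rnorm (f x) * w x <= M) ->
  l1 w f /\ l1_norm w f <= M.
Proof.
by move=> h; split; [exact: esum_lty (term_ge0 f) h|exact: esum_fine_le (term_ge0 f) h].
Qed.

Lemma l1_norm_ge0 f : l1 w f -> 0 <= l1_norm w f.
Proof.
by move=> f1; rewrite (le_trans _ (l1_fset_le fset0 f1)) // big_seq_fset0.
Qed.

Lemma l1_lin (a : R[i]) f g : l1 w f -> l1 w g ->
  l1 w (a *: f + g) /\
  l1_norm w (a *: f + g) <= rnorm a * l1_norm w f + l1_norm w g.
Proof.
move=> f1 g1; apply: l1P => A.
have fA := ler_wpM2l (rnorm_ge0 a) (l1_fset_le A f1).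
apply: le_trans (lerD fA (l1_fset_le A g1)).
rewrite mulr_sumr -big_split ler_sum //= => x _.
rewrite mulrA -rnormM -mulrDl ler_wpM2r //; exact: ler_rnormD.
Qed.

Lemma l1_sub f g : l1 w f -> l1 w g -> l1 w (f - g).
Proof. by move=> f1 g1; rewrite addrC -scaleN1r; apply: (l1_lin _ _ _).1. Qed.

Lemma l1_0 : l1 w 0.
Proof.
apply: (l1P (M := 0) _).1 => A.
by rewrite big1 // => x _; rewrite rnorm0 mul0r.
Qed.

Definition dirac_fun (x : G) : G -> R[i]^o := fun y => (y == x)%:R.

Lemma l1_dirac x : l1 w (dirac_fun x) /\ l1_norm w (dirac_fun x) <= w x.
Proof.
apply: l1P => A.
have h := @sum_single _ _ A (fun y => rnorm (dirac_fun x y) * w y) x.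
apply: le_trans (h _ _) _ => [y|y /negPf yx|].
- exact: term_ge0.
- by rewrite /dirac_fun yx rnorm0 mul0r.
- by rewrite /dirac_fun eqxx /rnorm normr1 mul1r.
Qed.

(** The truncation of [f] to a finite set is a combination of point masses, and the rest has small
    norm. Continuous linear identities on [l1] are thus checked on point masses; in [l1_rep_mul]
    this replaces the interchange of double sums. *)
Lemma l1_density (V : normedModType R[i]) (lam : (G -> R[i]^o) -> V) (M : R) :
  (forall (a : R[i]) f g, l1 w f -> l1 w g ->
     lam (a *: f + g) = a *: lam f + lam g) ->
  (forall f, l1 w f -> rnorm (lam f) <= M * l1_norm w f) ->
  (forall x, lam (dirac_fun x) = 0) -> forall f, l1 w f -> lam f = 0.
Proof.
move=> ll hM l0 f f1; apply: rnorm_le_eps => e e0.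
have M1 : 0 < `|M| + 1 by rewrite ltr_wpDl.
have [A hA] := esum_tail (term_ge0 f) f1 (divr_gt0 e0 M1).
pose fA : G -> R[i]^o := fun x => if x \in A then f x else 0.
have [fA1 lfA] : l1 w fA /\ lam fA = 0.
  have -> : fA = \sum_(x <- A) f x *: dirac_fun x.
    apply/funext => y; rewrite /fA fct_sumE.
    have [yA|yA] := boolP (y \in A).
      rewrite (big_fsetD1 y) //= big_seq big1 ?addr0; last first.
        move=> x; rewrite !inE => /andP[/negPf xy _].
        by rewrite -[LHS]/(f x * (y == x)%:R) eq_sym xy; apply: mulr0.
      by rewrite -[RHS]/(f y * (y == y)%:R) eqxx; apply/esym/mulr1.
    rewrite big_seq big1 // => x xA; rewrite -[LHS]/(f x * (y == x)%:R).
    have -> : (y == x) = false by apply: contraNF yA => /eqP ->.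
    exact: mulr0.
  have lam0 : lam 0 = 0.
    have := ll 1 0 0 l1_0 l1_0; rewrite !scale1r addr0 => /eqP.
    by rewrite -subr_eq subrr eq_sym => /eqP.
  elim: (enum_fset A) => [|x r [r1 lr]]; first by rewrite big_nil; split=> //; exact: l1_0.
  rewrite big_cons; split; first by apply: (l1_lin _ _ _).1 => //; apply: (l1_dirac x).1.
  by rewrite ll ?l0 ?lr ?scaler0 ?addr0 //; apply: (l1_dirac x).1.
have [g1 gle] : l1 w (f - fA) /\ l1_norm w (f - fA) <= e / (`|M| + 1).
  apply: l1P => B.
  have -> : \sum_(x <- B) rnorm ((f - fA) x) * w x =
            \sum_(x <- (B `\` A)%fset) rnorm (f x) * w x.
    rewrite (big_fsetID _ (mem A)) /= big_seq big1 ?add0r; last first.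
      move=> x; rewrite !inE /= => /andP[_ xA].
      have fAx : fA x = f x by rewrite /fA xA.
      by rewrite -[(f - fA) x]/(f x - fA x) fAx subrr rnorm0 mul0r.
    have -> : [fset x in B | x \notin mem A]%fset = (B `\` A)%fset.
      by apply/fsetP => x; rewrite !inE /= andbC.
    rewrite big_seq [RHS]big_seq; apply: eq_bigr => x; rewrite !inE => /andP[/negPf xA _].
    have fAx : fA x = 0 by rewrite /fA xA.
    by rewrite -[(f - fA) x]/(f x - fA x) fAx subr0.
  by apply: hA; apply/fdisjointP => x xA; rewrite !inE xA.
have -> : lam f = lam (f - fA).
  have := ll 1 (f - fA) fA g1 fA1.
  by rewrite !scale1r subrK lfA addr0.
rewrite (le_trans (hM _ g1)) //.
rewrite (@le_trans _ _ ((`|M| + 1) * (e / (`|M| + 1)))) //.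
  apply: le_trans (ler_wpM2l (ltW M1) gle).
  rewrite ler_wpM2r ?l1_norm_ge0 // (le_trans (ler_norm _)) // lerDl.
  exact: ler01.
by rewrite mulrC divfK // gt_eqF.
Qed.

Hypothesis wM : forall x y, w (x * y)%g <= w x * w y.

Let conv_term f g x y :
  rnorm (f y * g (y^-1 * x)%g) * w x <=
  (rnorm (f y) * w y) * (rnorm (g (y^-1 * x)%g) * w (y^-1 * x)%g).
Proof.
rewrite rnormM [leRHS]mulrACA ler_wpM2l ?mulr_ge0 ?rnorm_ge0 //.
by rewrite -{1}(mulVKg y x).
Qed.

Let mulVg_inj y : injective (fun x : G => (y^-1 * x)%g).
Proof. exact: mulgI. Qed.

Let conv_fset_le f g A B : l1 w f -> l1 w g ->
  \sum_(y <- B) \sum_(x <- A) rnorm (f y * g (y^-1 * x)%g) * w x <=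
  l1_norm w f * l1_norm w g.
Proof.
move=> f1 g1; apply: le_trans (ler_wpM2r (l1_norm_ge0 g1) (l1_fset_le B f1)).
rewrite mulr_suml ler_sum // => y _.
apply: le_trans (ler_sum _ (fun x _ => conv_term f g x y)) _.
rewrite -mulr_sumr ler_wpM2l ?term_ge0 //.
apply: (sum_fset_inj_le (a := fun z => rnorm (g z) * w z)); first exact: mulVg_inj.
by move=> D; apply: l1_fset_le.
Qed.

Lemma convolution_summable f g x : l1 w f -> l1 w g ->
  abs_summable (fun y => f y * g (y^-1 * x)%g : R[i]^o).
Proof.
move=> f1 g1; apply: (@esum_lty _ _ _ (l1_norm w f * l1_norm w g / w x)) => [y|B].
  exact: rnorm_ge0.
rewrite ler_pdivlMr // mulr_suml.
have := conv_fset_le [fset x]%fset B f1 g1.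
by under eq_bigr do rewrite big_seq_fset1.
Qed.

Lemma convolution_has_sum f g x : l1 w f -> l1 w g ->
  has_sum (fun y => f y * g (y^-1 * x)%g : R[i]^o) (convolution f g x).
Proof. by move=> f1 g1; apply/complex_abs_summable/convolution_summable. Qed.

(** The weight [w x] is at most [w y * w (y^-1 * x)], and the nonnegative sums over [x] and [y] may
    be exchanged. *)
Lemma l1_convolution f g : l1 w f -> l1 w g ->
  l1 w (convolution f g) /\
  l1_norm w (convolution f g) <= l1_norm w f * l1_norm w g.
Proof.
move=> f1 g1; apply: l1P => A.
pose a x y := rnorm (f y * g (y^-1 * x)%g) * w x.
have a0 x y : 0 <= a x y by rewrite mulr_ge0 ?rnorm_ge0.
have alt x : (\esum_(y in [set: G]) (a x y)%:E < +oo)%E.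
  apply: (@esum_lty _ _ _ (l1_norm w f * l1_norm w g)) => // B.
  have := conv_fset_le [fset x]%fset B f1 g1.
  by under eq_bigr do rewrite big_seq_fset1.
have le x : ((rnorm (convolution f g x) * w x)%:E <=
             \esum_(y in [set: G]) (a x y)%:E)%E.
  rewrite -esum_fineK // lee_fin -ler_pdivlMr //.
  apply: has_sum_rnorm_le (convolution_has_sum x f1 g1) _ => B.
  rewrite (le_trans (ler_rnorm_sum _ _)) // ler_pdivlMr // mulr_suml.
  exact: (@esum_fset_le _ _ (a x) B).
rewrite -lee_fin -sumEFin.
apply: (@le_trans _ _ (\sum_(x <- A) \esum_(y in [set: G]) (a x y)%:E)%E).
  by apply: lee_sum => x _; exact: le.
rewrite -esum_sum => [|y x _ _]; last by rewrite lee_fin.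
under eq_esum do rewrite sumEFin.
apply/esum_lefP => [y|B]; first by rewrite sumr_ge0.
exact: conv_fset_le.
Qed.

Lemma convolution_linl (a : R[i]) f f' g : l1 w f -> l1 w f' -> l1 w g ->
  convolution (a *: f + f') g = a *: convolution f g + convolution f' g.
Proof.
move=> f1 f1' g1; apply/funext => x.
have af := (l1_lin a f1 f1').1.
apply: (has_sum_unique (convolution_has_sum x af g1)).
have := has_sum_lin a (convolution_has_sum x f1 g1) (convolution_has_sum x f1' g1).
have <- : (fun y => (a *: f + f') y * g (y^-1 * x)%g : R[i]^o) =
  (fun y => a *: (f y * g (y^-1 * x)%g : R[i]^o) + f' y * g (y^-1 * x)%g).
  by apply/funext => y; rewrite mulrDl -scalerAl.
by [].
Qed.

End L1.

Section Dirac.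
Variables (R : realType) (G : groupType).

Lemma convolution_dirac (x : G) (g : G -> R[i]^o) :
  convolution (dirac_fun R x) g = fun y => g (x^-1 * y)%g.
Proof.
apply/funext => y; apply: has_sumE.
have := @has_sum_finite R G R[i]^o
  (fun z => dirac_fun R x z * g (z^-1 * y)%g) [fset x]%fset.
rewrite big_seq_fset1 /dirac_fun eqxx mul1r; apply => z.
by rewrite inE => /negPf ->; rewrite mul0r.
Qed.

Lemma convolution_dirac2 (x y : G) :
  convolution (dirac_fun R x) (dirac_fun R y) = dirac_fun R (x * y)%g.
Proof.
rewrite convolution_dirac; apply/funext => z; rewrite /dirac_fun.
by rewrite -(inj_eq (@mulgI _ x)) mulVKg.
Qed.

End Dirac.

(** * Representations by bounded group actions *)

Section Criterion.
Variables (R : realType) (G : groupType) (w : G -> R) (H : hilbertSpace R).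
Hypothesis w_gt0 : forall x, 0 < w x.
Hypothesis wM : forall x y, w (x * y)%g <= w x * w y.
Variables (E : G -> H -> H) (M : R).
Hypothesis E_lin : forall x, linear (E x).
Hypothesis E_mul : forall x y u, E x (E y u) = E (x * y)%g u.
Hypothesis M_ge0 : 0 <= M.
Hypothesis E_bnd : forall x u, rnorm (E x u) <= M * w x * rnorm u.
Implicit Types (f g : G -> R[i]^o) (A B : {fset G}) (u v : H).

Definition l1_rep f u : H := summability.sum (fun x => f x *: E x u).

Let w_ge0 x : 0 <= w x. Proof. exact: ltW. Qed.

Let Hcomplete : cauchy_complete H.
Proof. by move=> F FF; apply: cauchy_cvg. Qed.

Let rep_term f u x :
  rnorm (f x *: E x u) <= M * rnorm u * (rnorm (f x) * w x).
Proof.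
rewrite rnormZ mulrCA ler_wpM2l ?rnorm_ge0 // mulrAC; exact: E_bnd.
Qed.

Let rep_fset_le f u A : l1 w f ->
  \sum_(x <- A) rnorm (f x *: E x u) <= M * rnorm u * l1_norm w f.
Proof.
move=> f1; apply: le_trans (ler_sum _ (fun x _ => rep_term f u x)) _.
by rewrite -mulr_sumr ler_wpM2l ?mulr_ge0 ?rnorm_ge0 // l1_fset_le.
Qed.

Lemma l1_rep_has_sum f u : l1 w f ->
  has_sum (fun x => f x *: E x u) (l1_rep f u).
Proof.
move=> f1; apply: (abs_summable_has_sum Hcomplete).
by apply: esum_lty (fun A => rep_fset_le u A f1) => x; apply: rnorm_ge0.
Qed.

Lemma l1_rep_le f u : l1 w f ->
  rnorm (l1_rep f u) <= M * rnorm u * l1_norm w f.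
Proof.
move=> f1; apply: has_sum_rnorm_le (l1_rep_has_sum u f1) _ => A.
exact: le_trans (ler_rnorm_sum _ _) (rep_fset_le u A f1).
Qed.

Lemma l1_rep_linl (a : R[i]) f g u : l1 w f -> l1 w g ->
  l1_rep (a *: f + g) u = a *: l1_rep f u + l1_rep g u.
Proof.
move=> f1 g1; have af := (l1_lin w_gt0 a f1 g1).1.
apply: (has_sum_unique (l1_rep_has_sum u af)).
have := has_sum_lin a (l1_rep_has_sum u f1) (l1_rep_has_sum u g1).
have <- : (fun x => (a *: f + g) x *: E x u) =
  (fun x => a *: (f x *: E x u) + g x *: E x u).
  by apply/funext => x; rewrite scalerA -scalerDl.
by [].
Qed.

Lemma l1_rep_linr f : l1 w f -> linear (l1_rep f).
Proof.
move=> f1 a u v; apply: (has_sum_unique (l1_rep_has_sum _ f1)).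
have := has_sum_lin a (l1_rep_has_sum u f1) (l1_rep_has_sum v f1).
have <- : (fun x => f x *: E x (a *: u + v)) =
  (fun x => a *: (f x *: E x u) + f x *: E x v).
  by apply/funext => x; rewrite E_lin scalerDr !scalerA mulrC.
by [].
Qed.

Lemma l1_rep_bounded f : l1 w f -> bounded_operator (l1_rep f).
Proof.
move=> f1; split; first exact: l1_rep_linr.
by exists (M * l1_norm w f) => u; rewrite mulrAC; apply: l1_rep_le.
Qed.

Lemma opnorm_l1_rep f : l1 w f -> opnorm (l1_rep f) <= M * l1_norm w f.
Proof.
move=> f1; apply: opnorm_le => [|u]; first by rewrite mulr_ge0 ?l1_norm_ge0.
by rewrite mulrAC; apply: l1_rep_le.
Qed.

Lemma l1_rep_dirac x u : l1_rep (dirac_fun R x) u = E x u.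
Proof.
apply: has_sumE; have := @has_sum_finite R G H
  (fun y => dirac_fun R x y *: E y u) [fset x]%fset.
rewrite big_seq_fset1 {1 3}/dirac_fun eqxx scale1r; apply => y.
by rewrite inE => /negPf ->; rewrite scale0r.
Qed.

Lemma l1_translate y g : l1 w g ->
  l1 w (fun x => g (y^-1 * x)%g) /\
  l1_norm w (fun x => g (y^-1 * x)%g) <= w y * l1_norm w g.
Proof.
move=> g1; have [d1 dle] := l1_dirac w_gt0 y.
rewrite -convolution_dirac; have [c1 cle] := l1_convolution w_gt0 wM d1 g1.
split=> //; apply: le_trans cle _.
by rewrite ler_wpM2r ?l1_norm_ge0.
Qed.

Lemma l1_rep_translate y g u : l1 w g ->
  l1_rep (fun x => g (y^-1 * x)%g) u = E y (l1_rep g u).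
Proof.
move=> g1; apply/eqP; rewrite -subr_eq0; apply/eqP.
pose lam g := l1_rep (fun x => g (y^-1 * x)%g) u - E y (l1_rep g u).
apply: (@l1_density _ _ _ w_gt0 H lam (M * rnorm u * w y + M * w y * (M * rnorm u))) g1
  => [a f g' f1 g1'|f f1|x]; rewrite /lam.
- have -> : l1_rep (fun x => (a *: f + g') (y^-1 * x)%g) u =
      a *: l1_rep (fun x => f (y^-1 * x)%g) u + l1_rep (fun x => g' (y^-1 * x)%g) u.
    exact: l1_rep_linl (l1_translate y f1).1 (l1_translate y g1').1.
  by rewrite (l1_rep_linl _ _ f1 g1') E_lin opprD addrACA scalerBr.
- apply: le_trans (ler_rnormD _ _) _; rewrite rnormN mulrDl lerD //.
    have [t1 tle] := l1_translate y f1.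
    apply: le_trans (l1_rep_le u t1) _.
    by rewrite -[leRHS]mulrA ler_wpM2l ?mulr_ge0 ?rnorm_ge0.
  apply: le_trans (E_bnd _ _) _.
  by rewrite -[leRHS]mulrA ler_wpM2l ?mulr_ge0 ?l1_rep_le.
- rewrite l1_rep_dirac E_mul -convolution_dirac convolution_dirac2.
  by rewrite l1_rep_dirac subrr.
Qed.

Lemma l1_rep_mul f g : l1 w f -> l1 w g ->
  l1_rep (convolution f g) = l1_rep f \o l1_rep g.
Proof.
move=> f1 g1; apply/funext => u; apply/eqP; rewrite -subr_eq0; apply/eqP.
pose lam f := l1_rep (convolution f g) u - l1_rep f (l1_rep g u).
apply: (@l1_density _ _ _ w_gt0 H lam
   (M * rnorm u * l1_norm w g + M * rnorm (l1_rep g u))) f1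
  => [a f' g' f1 g1'|f' f1|x]; rewrite /lam.
- rewrite (convolution_linl w_gt0 wM) // !l1_rep_linl //;
    try exact: (l1_convolution w_gt0 wM _ _).1.
  by rewrite opprD addrACA scalerBr.
- have [c1 cle] := l1_convolution w_gt0 wM f1 g1.
  apply: le_trans (ler_rnormD _ _) _; rewrite rnormN mulrDl lerD ?l1_rep_le //.
  apply: le_trans (l1_rep_le u c1) _.
  by rewrite -[leRHS]mulrA ler_wpM2l ?mulr_ge0 ?rnorm_ge0 // mulrC.
- by rewrite convolution_dirac l1_rep_translate // l1_rep_dirac subrr.
Qed.

Variables (xi : (G -> bool) -> H) (ell : (G -> bool) -> H -> R[i]) (b : R).
Hypothesis b_ge0 : 0 <= b.
Hypothesis xi_le : forall phi, rnorm (xi phi) <= b.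
Hypothesis ell_lin : forall phi (a : R[i]) u v,
  ell phi (a *: u + v) = a * ell phi u + ell phi v.
Hypothesis ell_le : forall phi u, rnorm (ell phi u) <= rnorm u.
Hypothesis ell_E : forall phi x, ell phi (E x (xi phi)) = (-1) ^+ phi x * (w x)%:C.

(** A matrix coefficient of [T] that, on [l1_rep f], pairs [f] with [+-w] for the sign pattern [phi]
    ([sign_coef_has_sum]). Its bound is uniform in [phi]. *)
Definition sign_coef phi (T : H -> H) : R[i] := ell phi (T (xi phi)).

Let ell0 phi : ell phi 0 = 0.
Proof.
have := ell_lin phi 1 0 0; rewrite !scale1r addr0 mul1r => /eqP.
by rewrite -subr_eq subrr eq_sym => /eqP.
Qed.

Lemma sign_coef_le phi T : bounded_operator T ->
  rnorm (sign_coef phi T) <= b * opnorm T.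
Proof.
move=> bT; apply: le_trans (ell_le _ _) _; apply: le_trans (le_opnorm _ bT) _.
by rewrite mulrC ler_wpM2r ?opnorm_ge0.
Qed.

Lemma sign_coef_has_sum (phi : G -> bool) f : l1 w f ->
  has_sum (fun x => f x * ((-1) ^+ phi x * (w x)%:C) : R[i]^o)
    (sign_coef phi (l1_rep f)).
Proof.
move=> f1; have := @has_sum_bounded R G H R[i]^o (ell phi) 1 _ _ _ (ell0 phi) _
  (l1_rep_has_sum (xi phi) f1).
have -> : ell phi \o (fun x => f x *: E x (xi phi)) =
    (fun x => f x * ((-1) ^+ phi x * (w x)%:C)).
  apply/funext => x /=; have := ell_lin phi (f x) (E x (xi phi)) 0.
  by rewrite ell0 !addr0 ell_E.
apply=> [u v|v]; last by rewrite mul1r.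
by have := ell_lin phi 1 u v; rewrite scale1r mul1r.
Qed.

(** The pattern [phi] consists of the signs of [p (f x)], where [p] is to be the real or the
    imaginary part; the pairing with [+-w] then adds up the absolute values. Treating the two parts
    separately costs a factor 2 in the lower bound. *)
Let part_le (p : {additive R[i] -> R}) f A : l1 w f ->
  (forall z, `|p z| <= rnorm z) ->
  (forall z (r : R), p (z * r%:C) = p z * r) ->
  \sum_(x <- A) `|p (f x)| * w x <= b * opnorm (l1_rep f).
Proof.
move=> f1 ple pZ; pose phi x := p (f x) < 0.
apply: le_trans (sign_coef_le phi (l1_rep_bounded f1)).
apply/ler_addgt0Pr => e e0.
have [B hB] := sign_coef_has_sum phi f1 e0.
have /hB := fsubsetUr A B; set D := (A `|` B)%fset; set s := sign_coef _ _ => le.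
apply: (@le_trans _ _ (\sum_(x <- D) `|p (f x)| * w x)).
  rewrite [leRHS](@sum_fsetU_disj _ _ _ A) ?fsubsetUl // lerDl.
  by rewrite sumr_ge0 // => x _; rewrite mulr_ge0.
have -> : \sum_(x <- D) `|p (f x)| * w x =
    p (\sum_(x <- D) f x * ((-1) ^+ phi x * (w x)%:C)).
  rewrite raddf_sum; apply: eq_bigr => x _ /=.
  have -> : (-1) ^+ phi x * (w x)%:C = ((-1) ^+ phi x * w x)%:C :> R[i].
    by rewrite rmorphM /= rmorphXn /= rmorphN1.
  rewrite pZ mulrA; congr (_ * _); rewrite /phi.
  by case: ltrP => [/ltr0_norm ->|/ger0_norm ->]; rewrite ?expr1 ?mulrN1 ?mulr1.
apply: le_trans (ler_norm _) _; apply: le_trans (ple _) _.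
rewrite -(subrK s (\sum_(x <- D) _)) addrC.
by rewrite (le_trans (ler_rnormD _ _)) // lerD2l.
Qed.

Lemma l1_norm_le_opnorm f : l1 w f -> l1_norm w f <= b *+ 2 * opnorm (l1_rep f).
Proof.
move=> f1; apply: (l1P w_gt0 _).2 => A.
have hRe := @part_le (@complex.Re R) f A f1 (@ler_Re_rnorm R).
have hIm := @part_le (@complex.Im R) f A f1 (@ler_Im_rnorm R).
rewrite mulrnAl mulr2n; apply: le_trans (lerD (hRe _) (hIm _)).
- rewrite -big_split ler_sum //= => x _.
  by rewrite -mulrDl ler_wpM2r // ler_rnorm_ReIm.
- by case=> x y r /=; ring.
- by case=> x y r /=; ring.
Qed.

(** Two sign patterns that differ only at [x] isolate [2 f(x) w(x)]. The formula makes sense for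
    every operator, so it proposes a preimage for a limit of operators [l1_rep g]. *)
Let coef (T : H -> H) (x : G) : R[i] :=
  (sign_coef (fun=> false) T - sign_coef (pred1 x) T) / (w x *+ 2)%:C.

Let wn0 x : (w x *+ 2)%:C != 0 :> R[i].
Proof.
apply/eqP => /(@complexI R _ 0) w20.
by have := w_gt0 x; rewrite -(pmulrn_lgt0 _ (isT : 0 < 2)%N) w20 ltxx.
Qed.

Let coef_rep f x : l1 w f -> coef (l1_rep f) x = f x.
Proof.
move=> f1; apply: (canLR (mulfK (wn0 x))).
have h := has_sum_lin (-1) (sign_coef_has_sum (pred1 x) f1)
  (sign_coef_has_sum (fun=> false) f1).
rewrite addrC -scaleN1r; apply: has_sum_unique h _.
have := @has_sum_finite R G R[i]^o
  (fun y => if y == x then f x * (w x *+ 2)%:C else 0) [fset x]%fset.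
rewrite big_seq_fset1 eqxx => hs.
have <- : (fun y => if y == x then f x * (w x *+ 2)%:C else 0) =
   (fun y => (-1) *: (f y * ((-1) ^+ pred1 x y * (w y)%:C) : R[i]^o) +
     f y * ((-1) ^+ false * (w y)%:C)).
  apply/funext => y; rewrite scaleN1r /=; case: eqP => [->|_] /=.
    by rewrite expr0 expr1 raddfMn /= mulr2n; ring.
  by rewrite addrC subrr.
by apply: hs => y; rewrite inE => /negPf ->.
Qed.

Let coef_sub T f x : bounded_operator T -> l1 w f ->
  rnorm (coef T x - f x) * w x <= b * opnorm (T - l1_rep f).
Proof.
move=> bT f1; have bf := l1_rep_bounded f1.
have sub phi : sign_coef phi T - sign_coef phi (l1_rep f) =
    sign_coef phi (T - l1_rep f).
  have := ell_lin phi (-1) (l1_rep f (xi phi)) (T (xi phi)).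
  rewrite scaleN1r mulN1r /sign_coef [RHS]addrC => <-.
  by congr (ell phi _); apply: addrC.
rewrite -(coef_rep x f1) /coef -mulrBl.
have -> (a c a' c' : R[i]) : a - c - (a' - c') = (a - a') - (c - c') by ring.
rewrite !sub rnormM.
have -> : rnorm ((w x *+ 2)%:C^-1 : R[i]) = (w x *+ 2)^-1.
  by rewrite -fmorphV rnorm_real ger0_norm // invr_ge0 mulrn_wge0.
have -> : (w x *+ 2)^-1 = 2^-1 / w x by field; rewrite gt_eqF.
rewrite mulrA divfK ?gt_eqF // ler_pdivrMr // mulr_natr mulr2n.
apply: le_trans (ler_rnormD _ _) _; rewrite rnormN lerD //;
  by apply: sign_coef_le; apply: bounded_operatorB.
Qed.

Lemma group_action_operator_algebra :
  isomorphic_to_operator_algebra (l1 w) (@convolution R G) (l1_norm w).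
Proof.
exists H, (l1_rep @` l1 w), l1_rep; split.
- split.
  + by move=> _ [f f1 <-]; apply: l1_rep_bounded.
  + split.
      exists 0; first exact: l1_0.
      apply/funext => u; have := l1_rep_linl 1 u (l1_0 w_gt0) (l1_0 w_gt0).
      rewrite !scale1r addr0 => /eqP.
      by rewrite -subr_eq subrr eq_sym => /eqP.
    move=> a _ _ [f f1 <-] [g g1 <-]; exists (a *: f + g).
      exact: (l1_lin w_gt0 a f1 g1).1.
    by apply/funext => u; rewrite l1_rep_linl.
  + move=> _ _ [f f1 <-] [g g1 <-]; exists (convolution f g).
      exact: (l1_convolution w_gt0 wM f1 g1).1.
    by rewrite l1_rep_mul.
  + move=> T bT approx.
    have near (e : R) : 0 < e -> exists2 g, l1 w g & opnorm (T - l1_rep g) < e.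
      by move=> /approx[_ [g g1 <-] lt]; exists g.
    pose f0 : G -> R[i]^o := coef T.
    (* As [T] is not known to lie in the image, the lower norm bound is applied to [g' - g], where
       [l1_rep g'] approximates [T]; on a finite set [A] the passage from [g'] to [f0] is controlled
       coordinate by coordinate. *)
    have f0_sub g : l1 w g -> l1 w (f0 - g) /\
        l1_norm w (f0 - g) <= b *+ 2 * opnorm (T - l1_rep g).
      move=> g1; apply: (l1P w_gt0) => A; apply/ler_addgt0Pr => e e0.
      (* [size A * b] pays for the coordinates of [f0 - g'], [b *+ 2] for replacing [T] by
         [l1_rep g'], and 1 makes [n] positive. *)
      pose n := (size A)%:R * b + b *+ 2 + 1 : R.
      have n0 : 0 < n by rewrite ltr_wpDl // addr_ge0 ?mulr_ge0 ?mulrn_wge0.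
      have [g' g1' lt] := near _ (divr_gt0 e0 n0).
      have gg1 := l1_sub w_gt0 g1' g1.
      have bg := l1_rep_bounded g1; have bg' := l1_rep_bounded g1'.
      have h1 : \sum_(x <- A) rnorm ((f0 - g') x) * w x <= (size A)%:R * b * (e / n).
        apply: (@le_trans _ _ (\sum_(x <- A) b * (e / n))).
          apply: ler_sum => x _; apply: le_trans (coef_sub x bT g1') _.
          by rewrite ler_wpM2l // ltW.
        by rewrite big_const_seq count_predT iter_addr_0 -[leLHS]mulr_natl mulrA.
      have h2 : \sum_(x <- A) rnorm ((g' - g) x) * w x <=
          b *+ 2 * (opnorm (T - l1_rep g) + e / n).
        apply: le_trans (l1_fset_le w_gt0 A gg1) _.
        apply: le_trans (l1_norm_le_opnorm gg1) _.
        rewrite ler_wpM2l ?mulrn_wge0 //.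
        have -> : l1_rep (g' - g) = l1_rep g' - l1_rep g.
          apply/funext => u; rewrite addrC -scaleN1r l1_rep_linl // scaleN1r.
          by rewrite addrC.
        apply: le_trans (opnorm_sub_trans bg' bT bg) _.
        by rewrite addrC lerD2l opnorm_distC ltW.
      apply: (@le_trans _ _ (\sum_(x <- A) (rnorm ((f0 - g') x) * w x +
                rnorm ((g' - g) x) * w x))).
        apply: ler_sum => x _; rewrite -mulrDl ler_wpM2r //.
        have -> : (f0 - g) x = (f0 - g') x + (g' - g) x.
          by rewrite -[RHS]/((f0 x - g' x) + (g' x - g x)) subrKA.
        exact: ler_rnormD.
      rewrite big_split /=; apply: le_trans (lerD h1 h2) _.
      rewrite mulrDr addrCA lerD2l -mulrDl.
      have {2}-> : e = n * (e / n) by rewrite mulrC divfK // gt_eqF.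
      by rewrite ler_wpM2r ?divr_ge0 ?ltW // /n ltrDl.
    exists f0.
      have [g g1 _] := near 1 ltr01.
      by rewrite -[f0](subrK g) -[_ - g]scale1r; apply: (l1_lin w_gt0 _ (f0_sub g g1).1 g1).1.
    apply/funext => u; apply/eqP; rewrite -subr_eq0; apply/eqP.
    apply: rnorm_le_eps => e e0.
    (* The first term pays for [l1_rep (f0 - g)] at [u], the second for [T - l1_rep g] at [u]. *)
    pose n := (M * rnorm u * (b *+ 2) + rnorm u) + 1 : R.
    have n0 : 0 < n.
      by rewrite ltr_wpDl // addr_ge0 ?mulr_ge0 ?rnorm_ge0 ?mulrn_wge0.
    have [g g1 lt] := near _ (divr_gt0 e0 n0).
    have [s1 sle] := f0_sub g g1.
    have -> : l1_rep f0 u - T u = l1_rep (f0 - g) u - (T - l1_rep g) u.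
      have := l1_rep_linl 1 u s1 g1; rewrite !scale1r subrK => ->.
      by rewrite -[(T - l1_rep g) u]/(T u - l1_rep g u) opprB addrA.
    apply: le_trans (ler_rnormD _ _) _; rewrite rnormN.
    have bTg := bounded_operatorB bT (l1_rep_bounded g1).
    apply: le_trans (lerD (l1_rep_le u s1) (le_opnorm u bTg)) _.
    have h1 : M * rnorm u * l1_norm w (f0 - g) <= M * rnorm u * (b *+ 2 * (e / n)).
      rewrite ler_wpM2l ?mulr_ge0 ?rnorm_ge0 // (le_trans sle) //.
      by rewrite ler_wpM2l ?mulrn_wge0 // ltW.
    have h2 : opnorm (T - l1_rep g) * rnorm u <= rnorm u * (e / n).
      by rewrite mulrC ler_wpM2l ?rnorm_ge0 // ltW.
    apply: le_trans (lerD h1 h2) _; rewrite mulrA -mulrDl.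
    have {2}-> : e = n * (e / n) by rewrite mulrC divfK // gt_eqF.
    by rewrite ler_wpM2r ?divr_ge0 ?ltW // /n ltrDl.
- split.
  + by move=> f f1; exists f.
  + move=> f g; rewrite !inE => f1 g1 fg; apply/eqP; rewrite -subr_eq0; apply/eqP.
    apply/funext => x; rewrite -[LHS]/(f x - g x).
    by rewrite -(coef_rep x f1) fg coef_rep // subrr.
  + by move=> _ [f f1 <-]; exists f.
- by move=> a f g f1 g1; apply/funext => u; apply: l1_rep_linl.
- by move=> f g f1 g1; apply: l1_rep_mul.
- split; first by exists M => f f1; apply: opnorm_l1_rep.
  by exists (b *+ 2) => f f1; apply: l1_norm_le_opnorm.
Qed.

End Criterion.

(** * The representation attached to a weight *)

Section BoundedOnSpan.
Variables (R : realType) (I : choiceType).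
Implicit Types (f g : I -> R[i]^o) (L : (I -> R[i]^o) -> (I -> R[i]^o)).

Definition l2_bounded L := (forall (a : R[i]) f g, l2 f -> l2 g ->
    L (a *: f + g) = a *: L f + L g) /\
  exists2 M : R, 0 <= M & forall f, l2 f -> l2 (L f) /\ l2_norm (L f) <= M * l2_norm f.

Lemma l2_bounded_comp L L' : l2_bounded L -> l2_bounded L' -> l2_bounded (L \o L').
Proof.
move=> [ll [M M0 hM]] [ll' [M' M0' hM']]; split=> [a f g f2 g2 /=|].
  by rewrite ll' // ll //; [exact: (hM' f f2).1|exact: (hM' g g2).1].
exists (M * M'); first exact: mulr_ge0.
move=> f f2 /=; have [f2' le'] := hM' f f2; have [f2'' le] := hM _ f2'.
split=> //; apply: le_trans le _.
by rewrite -mulrA ler_wpM2l.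
Qed.

Lemma l2_functional_comp lam L : l2_functional lam -> l2_bounded L ->
  l2_functional (lam \o L).
Proof.
move=> [ll [M hM]] [lL [M' M0' hM']]; split=> [a f g f2 g2 /=|].
  by rewrite lL // ll //; [exact: (hM' f f2).1|exact: (hM' g g2).1].
exists (`|M| * M') => f f2 /=; have [f2' le'] := hM' f f2.
apply: le_trans (hM _ f2') _; rewrite -mulrA.
apply: (@le_trans _ _ (`|M| * l2_norm (L f))).
  by rewrite ler_wpM2r ?l2_norm_ge0 ?ler_norm.
by rewrite ler_wpM2l.
Qed.

Lemma l2_functional_coord_sub L L' i : l2_bounded L -> l2_bounded L' ->
  l2_functional (fun f => L f i - L' f i).
Proof.
move=> [lL [M M0 hM]] [lL' [M' M0' hM']]; split=> [a f g f2 g2|].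
  rewrite lL // lL' // mulrBr addrACA -opprD; exact: erefl.
exists (M + M') => f f2; rewrite (le_trans (ler_rnormD _ _)) // rnormN mulrDl.
have [Lf2 le] := hM f f2; have [Lf2' le'] := hM' f f2.
by rewrite lerD // (le_trans (l2_coord i _)).
Qed.

Variable D : set (I -> R[i]^o).
Hypothesis D_l2 : forall d, D d -> l2 d.

Lemma sub_l2_span d : D d -> l2_span D d.
Proof. by move=> Dd; split=> [|lam _]; [exact: D_l2|apply]. Qed.

(** An annihilator of [D] composed with [L] annihilates [D] again. Describing the span by
    functionals makes approximating sequences unnecessary here. *)
Lemma l2_span_stable L f : l2_bounded L -> (forall d, D d -> l2_span D (L d)) ->
  l2_span D f -> l2_span D (L f).
Proof.
move=> bL LD [f2 hf]; split=> [|lam ll lD].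
  by case: bL => _ [M _ hM]; exact: (hM f f2).1.
apply: (hf (lam \o L)); first exact: l2_functional_comp.
by move=> d /LD[_ /(_ lam ll lD)].
Qed.

(** Each coordinate of [L - L'] is a functional annihilating [D]. This extends the group law of
    translations from the generating vectors to the span. *)
Lemma l2_span_ext L L' f : l2_bounded L -> l2_bounded L' ->
  (forall d, D d -> L d = L' d) -> l2_span D f -> L f = L' f.
Proof.
move=> bL bL' LL' [f2 hf]; apply/funext => i; apply/eqP; rewrite -subr_eq0; apply/eqP.
apply: (hf (fun f => L f i - L' f i)); first exact: l2_functional_coord_sub.
by move=> d /LL' ->; rewrite subrr.
Qed.

(** The default [u] of [insubd] is never reached once [L] preserves the span. *)
Definition span_lift L (u : span_space D) : span_space D := insubd u (L (val u)).

Lemma val_span_lift L u : l2_bounded L -> (forall d, D d -> l2_span D (L d)) ->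
  val (span_lift L u) = L (val u).
Proof.
move=> bL LD; rewrite /span_lift insubdK //; apply/asboolP.
by apply: l2_span_stable => //; apply: span_spaceP.
Qed.

End BoundedOnSpan.

Lemma esum_prod_sum (R : realType) (P X Y : choiceType) (a : P * (X + Y) -> \bar R) :
  (forall i, (0 <= a i)%E) ->
  (\esum_(i in [set: P * (X + Y)]) a i =
   \esum_(p in [set: P]) (\esum_(x in [set: X]) a (p, inl x) +
     \esum_(y in [set: Y]) a (p, inr y)))%E.
Proof.
move=> a0; pose a' p z := a (p, z).
transitivity (\esum_(p in [set: P]) \esum_(z in [set: X + Y]) a' p z)%E.
  rewrite esum_esum; last by move=> *; exact: a0.
  have -> : [set: P] `*`` (fun=> [set: X + Y]) = [set: P * (X + Y)].
    by apply/seteqP; split=> // -[p z].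
  by apply: eq_esum => -[p z].
apply: eq_esum => p _; rewrite (esumID (range (@inl X Y))); last by move=> *; exact: a0.
rewrite !setTI; congr (_ + _)%E.
  apply: reindex_esum; split.
  - by move=> x _; exists x.
  - by move=> x y _ _ [].
  - by move=> _ [x _ <-]; exists x.
apply: reindex_esum; split.
- by move=> y _ /= [x _].
- by move=> x y _ _ [].
- by move=> [x|y] /= h; [case: h; exists x|exists y].
Qed.

(** * The Hilbert space built from functionals along words *)

Section Construction.
Variables (R : realType) (G : groupType) (w h : G -> R) (K eps : R).
Hypothesis w_gt0 : forall x, 0 < w x.
Hypothesis h_gt0 : forall x, 0 < h x.
Hypothesis h_le1 : forall x, h x <= 1.
Hypothesis h_sum : forall A : {fset G}, \sum_(x <- A) h x ^+ 2 <= K.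
Hypothesis hw : forall v x, h (v * x)%g * w (v * x)%g <= w v * (h x * w x).
Hypothesis dichotomy : forall v x,
  w (v * x)%g <= h x ^+ 2 * (w v * w x) \/ w (v * x)%g <= h v * (w v * w x).
Hypothesis eps_gt0 : 0 < eps.
Hypothesis epsK : eps ^+ 2 * K <= 2^-1.

Let w_ge0 x : 0 <= w x. Proof. exact: ltW. Qed.
Let h_ge0 x : 0 <= h x. Proof. exact: ltW. Qed.

Let K_ge0 : 0 <= K.
Proof. by have := h_sum fset0; rewrite big_seq_fset0. Qed.

Let h2_le1 x : h x ^+ 2 <= 1.
Proof. by rewrite expr_le1. Qed.

Lemma weight_submul v x : w (v * x)%g <= w v * w x.
Proof.
have wvx : 0 <= w v * w x by rewrite mulr_ge0.
case: (dichotomy v x) => /le_trans; apply.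
  by rewrite -[leRHS]mul1r ler_wpM2r.
by rewrite -[leRHS]mul1r ler_wpM2r.
Qed.

Definition decays v x := w (v * x)%g <= h x ^+ 2 * (w v * w x).

(* The coefficient functional of [phi] along the word [V]: each letter [v] acts
   by translation and keeps only the part supported where [decays v] fails;
   there the loss [h v] makes division by [h v * w v] harmless. *)
Fixpoint word_coef (phi : G -> bool) (V : seq G) (x : G) : R :=
  if V is v :: V' then
    if decays v x then 0 else word_coef phi V' (v * x)%g / (h v * w v)
  else (-1) ^+ phi x * w x.

Fixpoint word_weight (V : seq G) : R :=
  if V is v :: V' then eps * h v * word_weight V' else 1.

Definition decay_coef v phi V x : R :=
  if decays v x then word_coef phi V (v * x)%g else 0.

Lemma word_coefE v phi V x : word_coef phi V (v * x)%g =
  decay_coef v phi V x + h v * w v * word_coef phi (v :: V) x.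
Proof.
rewrite /decay_coef /=; case: ifP => _; first by rewrite mulr0 addr0.
by rewrite add0r [RHS]mulrC divfK // mulf_neq0 // gt_eqF.
Qed.

(** Where [decays v x] fails, the other alternative of [dichotomy] holds, and its factor [h v * w v]
    is exactly the denominator in the recursion. *)
Lemma word_coef_le phi V x : `|word_coef phi V x| <= w x.
Proof.
elim: V x => [|v V IH] x /=.
  by rewrite normrM normrX normrN1 expr1n mul1r gtr0_norm.
case: ifPn => [_|]; first by rewrite normr0.
rewrite /decays => nc; have wle : w (v * x)%g <= h v * (w v * w x).
  by case: (dichotomy v x) => // c; rewrite c in nc.
have hwv : 0 < h v * w v by rewrite mulr_gt0.
rewrite normrM normfV (gtr0_norm hwv) ler_pdivrMr //.
by rewrite (le_trans (IH _)) // (le_trans wle) // mulrA mulrC.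
Qed.

Lemma decay_coef_le v phi V x :
  `|decay_coef v phi V x| <= h x ^+ 2 * (w v * w x).
Proof.
rewrite /decay_coef; case: ifPn => [c|_].
  exact: le_trans (word_coef_le _ _ _) c.
by rewrite normr0 !mulr_ge0 ?sqr_ge0.
Qed.

Lemma word_weight_gt0 V : 0 < word_weight V.
Proof. by elim: V => //= v V IH; rewrite !mulr_gt0. Qed.

Let word_weight_ge0 V : 0 <= word_weight V.
Proof. exact/ltW/word_weight_gt0. Qed.

(** Words of length [n] contribute at most [(eps^2 K)^n <= 2^-n], a geometric series with sum 2. The
    induction on the maximal length splits a nonempty word into head and tail and closes because
    [1 + 2^-1 * 2 = 2]. *)
Lemma word_weight_sum (A : {fset seq G}) : \sum_(V <- A) word_weight V ^+ 2 <= 2.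
Proof.
suff bnd n (B : {fset seq G}) : (forall V, V \in B -> size V <= n)%N ->
    \sum_(V <- B) word_weight V ^+ 2 <= 2.
  apply: (bnd (\max_(V <- A) size V)) => V VA.
  by apply: (leq_bigmax_seq (F := size)).
elim: n B => [|n IH] B hB.
  apply: (@le_trans _ _ (\sum_(V <- [fset [::]]%fset) word_weight V ^+ 2)).
    have sB : (B `<=` [fset [::]])%fset.
      by apply/fsubsetP => V /hB; rewrite leqn0 size_eq0 inE.
    by rewrite [leRHS](sum_fsetU_disj _ sB) lerDl sumr_ge0 // => V _; rewrite sqr_ge0.
  by rewrite big_seq_fset1 /= expr1n ler1n.
(* An empty word in [B] adds the default head [1] and an empty tail; this only enlarges [prods], and
   an upper bound is wanted. The length test in [tails] supplies the premise of the induction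
   hypothesis. *)
pose heads := [fset head 1%g V | V in B]%fset.
pose tails := [fset V in [fset behead V | V in B] | (size V <= n)%N]%fset.
pose prods := [fset (p.1 :: p.2) | p in (heads `*` tails)%fset]%fset.
have sB : (B `<=` [fset [::]] `|` prods)%fset.
  apply/fsubsetP => -[|v V] VB; rewrite !inE //=; apply/imfsetP.
  exists (v, V) => //; rewrite !inE /=; apply/andP; split.
    by apply/imfsetP; exists (v :: V).
  apply/andP; split; last exact: (hB _ VB).
  by apply/imfsetP; exists (v :: V).
apply: (@le_trans _ _ (\sum_(V <- ([fset [::]] `|` prods)%fset) word_weight V ^+ 2)).
  by rewrite [leRHS](sum_fsetU_disj _ sB) lerDl sumr_ge0 // => V _; rewrite sqr_ge0.
have s1 : ([fset [::]] `<=` [fset [::]] `|` prods)%fset by rewrite fsubsetUl.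
rewrite (sum_fsetU_disj _ s1) big_seq_fset1 /= expr1n.
have -> : (([fset [::]] `|` prods) `\` [fset [::]])%fset = prods.
  apply/fsetP => V; rewrite !inE; case: eqP => [->|//] /=.
  by apply/esym/negbTE/imfsetP => -[].
rewrite big_imfset /=; last by move=> [v V] [v' V'] _ _ [-> ->].
have -> : \sum_(p <- (heads `*` tails)%fset) (eps * h p.1 * word_weight p.2) ^+ 2 =
    (eps ^+ 2 * \sum_(v <- heads) h v ^+ 2) * \sum_(V <- tails) word_weight V ^+ 2.
  rewrite -mulrA mulr_suml mulr_sumr.
  rewrite (perm_big [seq (v, V) | v <- heads, V <- tails]); last first.
    apply: uniq_perm => [||[v V]]; first exact: fset_uniq.
      by apply: allpairs_uniq => [||[? ?] [? ?] _ _ [-> ->]]; rewrite ?fset_uniq.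
    rewrite in_fsetM; apply/andP/allpairsP => [[vh Vt]|[[v' V'] /= [vh Vt [-> ->]]]] //.
    by exists (v, V).
  rewrite big_allpairs; apply: eq_bigr => v _; rewrite !mulr_sumr; apply: eq_bigr => V _.
  by rewrite !exprMn mulrA.
have tl : \sum_(V <- tails) word_weight V ^+ 2 <= 2.
  by apply: IH => V; rewrite !inE => /andP[].
have hd : eps ^+ 2 * \sum_(v <- heads) h v ^+ 2 <= 2^-1.
  by apply: le_trans epsK; rewrite ler_wpM2l ?sqr_ge0.
have : (eps ^+ 2 * \sum_(v <- heads) h v ^+ 2) *
    \sum_(V <- tails) word_weight V ^+ 2 <= 2^-1 * 2.
  have e1 : 0 <= eps ^+ 2 * \sum_(v <- heads) h v ^+ 2.
    exact: mulr_ge0 (sqr_ge0 _) (sumr_ge0 _ (fun v _ => sqr_ge0 _)).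
  exact: ler_pM e1 (sumr_ge0 _ (fun V _ => sqr_ge0 _)) hd tl.
rewrite mulVf //; lra.
Qed.

Let index : choiceType := ((G -> bool) * (G + seq G))%type.
Implicit Types (f g : index -> R[i]^o).

(** The weight of the l^2 part. A functional bounded by [h ^+ 2 * w = h * k] is continuous there by
    Cauchy-Schwarz, and [hw] says that translation by [v] has norm at most [w v] there. *)
Let k x := h x * w x.

Let k_gt0 x : 0 < k x. Proof. exact: mulr_gt0. Qed.

(** The image of the point mass at [x] in the summand of [phi]: one weighted l^2 coordinate, and the
    values at [x] of all word functionals, scaled by their constants. *)
Definition base_vec (phi : G -> bool) (x : G) : index -> R[i]^o := fun i =>
  if i.1 == phi then
    match i.2 with
    | inl y => (if y == x then k x else 0)%:C
    | inr V => (word_weight V * word_coef phi V x)%:C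
    end
  else 0.

Definition decay_term v phi V f : G -> R[i]^o :=
  fun x => (decay_coef v phi V x / k x)%:C * f (phi, inl x).

(** Forced by the wish to send the image of the point mass at [x] to that at [v * x]. By
    [word_coefE] the word coordinate splits. Its decaying part is a functional of the group
    coordinates, whose weight is removed by the division by [k x] in [decay_term]. The other part
    reads the coordinate at [v :: V], because [word_weight V * (h v * w v) = w v / eps * word_weight
    (v :: V)]: the factor [h v] cancels. *)
Definition group_act (v : G) f : index -> R[i]^o := fun i =>
  match i.2 with
  | inl x => (k x / k (v^-1 * x)%g)%:C * f (i.1, inl (v^-1 * x)%g)
  | inr V => (word_weight V)%:C * summability.sum (decay_term v i.1 V f) +
             (w v / eps)%:C * f (i.1, inr (v :: V))
  end.

Lemma group_act_base v phi x : group_act v (base_vec phi x) = base_vec phi (v * x)%g.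
Proof.
apply/funext => -[phi' [y|V]]; rewrite /group_act /base_vec /=.
  case: eqP => _; last by rewrite mulr0.
  rewrite -rmorphM /=; congr (_%:C).
  have -> : (v^-1 * y == x)%g = (y == v * x)%g.
    by rewrite -(inj_eq (@mulgI _ v)) mulVKg.
  case: eqP => [->|_]; last by rewrite mulr0.
  by rewrite mulKg divfK // gt_eqF.
have -> : summability.sum (decay_term v phi' V (base_vec phi x)) =
    if phi' == phi then (decay_coef v phi V x)%:C else 0.
  apply: has_sumE; have := @has_sum_finite R G R[i]^o
    (decay_term v phi' V (base_vec phi x)) [fset x]%fset.
  have Ex : decay_term v phi' V (base_vec phi x) x =
      (decay_coef v phi' V x / k x)%:C * (if phi' == phi then (k x)%:C else 0).
    by rewrite /decay_term /base_vec /= eqxx.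
  rewrite big_seq_fset1 Ex; case: eqP => [->|/eqP/negPf phiN].
    rewrite -rmorphM /= divfK ?gt_eqF //; apply=> y.
    by rewrite inE /decay_term /base_vec /= eqxx => /negPf ->; rewrite mulr0.
  rewrite mulr0; apply => y _.
  by rewrite /decay_term /base_vec /= phiN mulr0.
case: eqP => [_|_]; last by rewrite !mulr0 addr0.
rewrite -!rmorphM -rmorphD /=; congr (_%:C).
rewrite [in RHS](word_coefE v) mulrDr; congr (_ + _) => /=.
have w0 : w v != 0 by rewrite gt_eqF.
have h0 : h v != 0 by rewrite gt_eqF.
have e0 : eps != 0 by rewrite gt_eqF.
by case: ifP => _; field; rewrite ?w0 ?h0 ?e0.
Qed.

Let q f i := rnorm (f i) ^+ 2.
Let P f phi := fine (\esum_(x in [set: G]) (q f (phi, inl x))%:E).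
Let Q f phi := fine (\esum_(V in [set: seq G]) (q f (phi, inr V))%:E).

Let q_ge0 f i : 0 <= q f i. Proof. exact: sqr_ge0. Qed.

Let P_fset_le f phi (A : {fset G}) : l2 f ->
  \sum_(x <- A) q f (phi, inl x) <= P f phi.
Proof.
move=> f2; apply: (@esum_fset_le _ _ (fun x => q f (phi, inl x))) => [//|].
apply: (@esum_lty _ _ (fun x => q f (phi, inl x)) (l2_sq f)) => // B.
apply: (sum_fset_inj_le (e := fun x : G => (phi, inl x) : index) (a := q f)).
  by move=> x y [].
by move=> D; apply: l2_sum_le.
Qed.

Let Q_fset_le f phi (A : {fset seq G}) : l2 f ->
  \sum_(V <- A) q f (phi, inr V) <= Q f phi.
Proof.
move=> f2; apply: (@esum_fset_le _ _ (fun V => q f (phi, inr V))) => [//|].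
apply: (@esum_lty _ _ (fun V => q f (phi, inr V)) (l2_sq f)) => // B.
apply: (sum_fset_inj_le (e := fun V : seq G => (phi, inr V) : index) (a := q f)).
  by move=> x y [].
by move=> D; apply: l2_sum_le.
Qed.

Let P_ge0 f phi : 0 <= P f phi.
Proof. by apply: fine_ge0; apply: esum_ge0 => x _; rewrite lee_fin. Qed.

Let Q_ge0 f phi : 0 <= Q f phi.
Proof. by apply: fine_ge0; apply: esum_ge0 => x _; rewrite lee_fin. Qed.

Let PQ_sum f (B : {fset (G -> bool)}) : l2 f ->
  \sum_(phi <- B) (P f phi + Q f phi) <= l2_sq f.
Proof.
move=> f2.
have PE phi : (\esum_(x in [set: G]) (q f (phi, inl x))%:E = (P f phi)%:E)%E.
  rewrite /P esum_fineK //.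
  by apply: (@esum_lty _ _ (fun x => q f (phi, inl x)) (P f phi)) => // A;
    exact: P_fset_le.
have QE phi : (\esum_(V in [set: seq G]) (q f (phi, inr V))%:E = (Q f phi)%:E)%E.
  rewrite /Q esum_fineK //.
  by apply: (@esum_lty _ _ (fun V => q f (phi, inr V)) (Q f phi)) => // A;
    exact: Q_fset_le.
have PQ0 phi : 0 <= P f phi + Q f phi by rewrite addr_ge0.
apply: (esum_lefP _ PQ0).1.
have -> : ((l2_sq f)%:E = \esum_(i in [set: index]) (q f i)%:E)%E.
  exact: esum_fineK (q_ge0 f) f2.
rewrite (@esum_prod_sum _ _ _ _ (fun i => (q f i)%:E)); last by move=> i; rewrite lee_fin.
by apply: le_esum => phi _; rewrite PE QE.
Qed.

Let l2_by_fibers g (s : (G -> bool) -> R) (M : R) :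
  (forall phi (A : {fset G}) (A' : {fset seq G}),
    \sum_(x <- A) q g (phi, inl x) + \sum_(V <- A') q g (phi, inr V) <= s phi) ->
  (forall B : {fset (G -> bool)}, \sum_(phi <- B) s phi <= M) ->
  l2 g /\ l2_sq g <= M.
Proof.
move=> hs hM.
have s0 phi : 0 <= s phi by have := hs phi fset0 fset0; rewrite !big_seq_fset0 addr0.
suff le : (\esum_(i in [set: index]) (q g i)%:E <= M%:E)%E.
  by apply: l2P => A; apply: (esum_lefP _ (q_ge0 g)).1.
rewrite (@esum_prod_sum _ _ _ _ (fun i => (q g i)%:E)); last by move=> i; rewrite lee_fin.
apply: le_trans ((esum_lefP _ s0).2 hM); apply: le_esum => phi _.
pose t := fine (\esum_(V in [set: seq G]) (q g (phi, inr V))%:E).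
have tE : (\esum_(V in [set: seq G]) (q g (phi, inr V))%:E = t%:E)%E.
  rewrite /t esum_fineK //.
  apply: (@esum_lty _ _ (fun V => q g (phi, inr V)) (s phi)) => // A'.
  by have := hs phi fset0 A'; rewrite big_seq_fset0 add0r.
rewrite tE -leeBrDr // -EFinB; apply/esum_lefP => // A.
rewrite lerBrDr -lerBrDl; apply: esum_fine_le => // A'.
by rewrite lerBrDl.
Qed.

(** The coefficient [decay_coef / k] is at most [w v * h] in absolute value; Cauchy-Schwarz against
    [h] gives the factor [K]. *)
Let decay_term_le v phi V f (A : {fset G}) : l2 f ->
  \sum_(x <- A) rnorm (decay_term v phi V f x) <= w v * Num.sqrt (K * P f phi).
Proof.
move=> f2; apply: (@le_trans _ _ (w v * \sum_(x <- A) h x * rnorm (f (phi, inl x)))).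
  rewrite mulr_sumr ler_sum // => x _; rewrite /decay_term rnormM rnorm_real.
  rewrite mulrA ler_wpM2r ?rnorm_ge0 // normrM normfV (gtr0_norm (k_gt0 x)).
  rewrite ler_pdivrMr // (le_trans (decay_coef_le _ _ _ _)) // /k.
  by rewrite expr2 -!mulrA mulrCA [leRHS]mulrCA ler_wpM2l // mulrCA.
rewrite ler_wpM2l // -(@ler_pXn2r _ 2) ?nnegrE ?sqrtr_ge0 //; last first.
  by rewrite sumr_ge0 // => x _; rewrite mulr_ge0 ?rnorm_ge0.
rewrite sqr_sqrtr ?mulr_ge0 //.
apply: le_trans (CauchySchwarz_seq h (fun x => rnorm (f (phi, inl x))) A) _.
rewrite ler_pM ?h_sum ?P_fset_le // sumr_ge0 // => x _; exact: sqr_ge0.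
Qed.

Let decay_has_sum v phi V f : l2 f ->
  has_sum (decay_term v phi V f) (summability.sum (decay_term v phi V f)).
Proof.
move=> f2; apply: complex_abs_summable.
apply: esum_lty (fun A => decay_term_le v phi V A f2) => x; exact: rnorm_ge0.
Qed.

Let decay_sum_le v phi V f : l2 f ->
  rnorm (summability.sum (decay_term v phi V f)) ^+ 2 <= w v ^+ 2 * (K * P f phi).
Proof.
move=> f2; have -> : w v ^+ 2 * (K * P f phi) = (w v * Num.sqrt (K * P f phi)) ^+ 2.
  by rewrite exprMn sqr_sqrtr ?mulr_ge0.
rewrite ler_pXn2r ?nnegrE ?rnorm_ge0 ?mulr_ge0 ?sqrtr_ge0 //.
apply: has_sum_rnorm_le (decay_has_sum v phi V f2) _ => A.
exact: le_trans (ler_rnorm_sum _ _) (decay_term_le v phi V A f2).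
Qed.

(** 1 bounds the shift of the group coordinates; [K *+ 4] the decaying part, with one 2 from
    [(a + b)^2 <= 2 a^2 + 2 b^2] and one from [word_weight_sum]; [(eps ^- 2) *+ 2] the shift of
    words. It bounds the squared norm of translation over [w v ^+ 2] and, being at least 1, also the
    norm over [w v]. *)
Definition act_bound : R := 1 + K *+ 4 + (eps ^- 2) *+ 2.

Lemma act_bound_ge1 : 1 <= act_bound.
Proof. by rewrite /act_bound -addrA lerDl addr_ge0 ?mulrn_wge0 // invr_ge0 sqr_ge0. Qed.

Lemma l2_group_act v f : l2 f ->
  l2 (group_act v f) /\ l2_norm (group_act v f) <= act_bound * w v * l2_norm f.
Proof.
move=> f2; pose s phi := act_bound * w v ^+ 2 * (P f phi + Q f phi).
have [] := @l2_by_fibers (group_act v f) s (act_bound * w v ^+ 2 * l2_sq f).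
- move=> phi A A'.
  have h1 : \sum_(x <- A) q (group_act v f) (phi, inl x) <= w v ^+ 2 * P f phi.
    apply: (@le_trans _ _ (w v ^+ 2 * \sum_(x <- A) q f (phi, inl (v^-1 * x)%g))).
      rewrite mulr_sumr ler_sum // => x _; rewrite /q /group_act /=.
      rewrite rnormM rnorm_real exprMn ler_wpM2r ?sqr_ge0 //.
      have k0 : 0 <= k x / k (v^-1 * x)%g by rewrite divr_ge0 // ltW.
      rewrite (ger0_norm k0) ler_pXn2r ?nnegrE //.
      by rewrite ler_pdivrMr // /k -{1 2}(mulVKg v x) hw.
    rewrite ler_wpM2l ?sqr_ge0 //.
    apply: (sum_fset_inj_le (e := fun x : G => (v^-1 * x)%g)
      (a := fun x => q f (phi, inl x))); first exact: mulgI.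
    by move=> B; apply: P_fset_le.
  have h2 : \sum_(V <- A') q (group_act v f) (phi, inr V) <=
      2 * (w v ^+ 2 * (K * P f phi)) * \sum_(V <- A') word_weight V ^+ 2 +
      2 * (w v / eps) ^+ 2 * \sum_(V <- A') q f (phi, inr (v :: V)).
    rewrite !mulr_sumr -big_split ler_sum //= => V _; rewrite /q /group_act /=.
    pose a : R[i]^o := (word_weight V)%:C * summability.sum (decay_term v phi V f).
    pose b : R[i]^o := (w v / eps)%:C * f (phi, inr (v :: V)).
    rewrite -[X in rnorm X ^+ 2 <= _]/(a + b).
    have ab : rnorm (a + b) ^+ 2 <= (rnorm a + rnorm b) ^+ 2.
      by rewrite ler_pXn2r ?nnegrE ?addr_ge0 ?rnorm_ge0 ?ler_rnormD.
    have aE : rnorm a ^+ 2 <= word_weight V ^+ 2 * (w v ^+ 2 * (K * P f phi)).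
      rewrite /a rnormM exprMn rnorm_real ger0_norm // ler_wpM2l ?sqr_ge0 //.
      exact: decay_sum_le.
    have bE : rnorm b ^+ 2 = (w v / eps) ^+ 2 * rnorm (f (phi, inr (v :: V))) ^+ 2.
      by rewrite /b rnormM exprMn rnorm_real ger0_norm // divr_ge0 // ltW.
    have := sqr_ge0 (rnorm a - rnorm b); rewrite sqrrB.
    rewrite sqrrD in ab; rewrite -[2 * _ * q f _]mulrA /q -bE.
    rewrite -mulrA [_ * word_weight V ^+ 2]mulrC; lra.
  have h3 : \sum_(V <- A') q f (phi, inr (v :: V)) <= Q f phi.
    apply: (sum_fset_inj_le (e := cons v) (a := fun V => q f (phi, inr V))).
      by move=> V V' [].
    by move=> B; apply: Q_fset_le.
  have h4 : 2 * (w v ^+ 2 * (K * P f phi)) * \sum_(V <- A') word_weight V ^+ 2 <=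
      2 * (w v ^+ 2 * (K * P f phi)) * 2.
    by rewrite ler_wpM2l ?word_weight_sum // !mulr_ge0 ?sqr_ge0.
  have h5 : 2 * (w v / eps) ^+ 2 * \sum_(V <- A') q f (phi, inr (v :: V)) <=
      2 * (w v / eps) ^+ 2 * Q f phi.
    by rewrite ler_wpM2l // mulr_ge0 ?sqr_ge0.
  have h6 : 0 <= w v ^+ 2 * K * Q f phi by rewrite !mulr_ge0 ?sqr_ge0.
  have h7 : 0 <= w v ^+ 2 * Q f phi by rewrite !mulr_ge0 ?sqr_ge0.
  have h8 : 0 <= w v ^+ 2 * eps ^- 2 * P f phi.
    by rewrite !mulr_ge0 ?sqr_ge0 ?invr_ge0 ?sqr_ge0.
  rewrite /s /act_bound; move: h1 h2 h4 h5; rewrite exprMn exprVn; lra.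
- by move=> B; rewrite -mulr_sumr ler_wpM2l ?PQ_sum // mulr_ge0 ?sqr_ge0 //
    (le_trans ler01) ?act_bound_ge1.
move=> g2 gle; split=> //.
have ab0 : 0 <= act_bound by rewrite (le_trans ler01) ?act_bound_ge1.
rewrite -(@ler_pXn2r _ 2) ?nnegrE ?l2_norm_ge0 ?mulr_ge0 ?l2_norm_ge0 //.
rewrite sqr_l2_norm (le_trans gle) // exprMn sqr_l2_norm.
rewrite ler_wpM2r ?l2_sq_ge0 // exprMn ler_wpM2r ?sqr_ge0 //.
by rewrite expr2 ler_peMr ?act_bound_ge1.
Qed.

Lemma group_act_bounded v : l2_bounded (group_act v).
Proof.
split; last first.
  exists (act_bound * w v) => [|f]; last exact: l2_group_act.
  by rewrite mulr_ge0 // (le_trans ler01) ?act_bound_ge1.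
move=> a f g f2 g2.
have comb (A s t B y z : R[i]) :
    A * (a * s + t) + B * (a * y + z) = a * (A * s + B * y) + (A * t + B * z).
  by ring.
apply/funext => -[phi [x|V]]; rewrite /group_act /=.
  by rewrite [LHS]mulrDr; congr (_ + _); apply: mulrCA.
have -> : summability.sum (decay_term v phi V (a *: f + g)) =
    a * summability.sum (decay_term v phi V f) + summability.sum (decay_term v phi V g).
  apply: has_sumE; have := has_sum_lin a (decay_has_sum v phi V f2)
    (decay_has_sum v phi V g2).
  have -> // : (fun x => a *: decay_term v phi V f x + decay_term v phi V g x) =
     decay_term v phi V (a *: f + g).
  apply/funext => x; rewrite /decay_term [RHS]mulrDr; congr (_ + _).
  exact: mulrCA.
exact: comb.
Qed.

(** The group coordinate contributes at most [w x ^+ 2] and the words at most [2 * w x ^+ 2]; the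
    factor 3 is rounded up to the square 4. *)
Lemma l2_base_vec phi x :
  l2 (base_vec phi x) /\ l2_norm (base_vec phi x) <= 2 * w x.
Proof.
have [] := @l2_by_fibers (base_vec phi x)
   (fun phi' => if phi' == phi then (2 * w x) ^+ 2 else 0) ((2 * w x) ^+ 2).
- move=> phi' A A'; rewrite /q /base_vec /=; case: eqP => [_|_]; last first.
    by rewrite !big1 ?addr0 // => *; rewrite rnorm0 expr0n.
  have h1 : \sum_(y <- A) rnorm ((if y == x then k x else 0)%:C : R[i]^o) ^+ 2 <= w x ^+ 2.
    apply: le_trans (sum_single (x := x) A _ _) _ => [y|y /negPf ->|].
    - exact: sqr_ge0.
    - by rewrite rnorm0 expr0n.
    - rewrite eqxx rnorm_real (gtr0_norm (k_gt0 x)) ler_pXn2r ?nnegrE //; last exact: ltW.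
      by rewrite /k -[leRHS]mul1r ler_wpM2r.
  have h2 : \sum_(V <- A')
      rnorm ((word_weight V * word_coef phi V x)%:C : R[i]^o) ^+ 2 <= 2 * w x ^+ 2.
    apply: le_trans (ler_wpM2r (sqr_ge0 _) (word_weight_sum A')).
    rewrite mulr_suml ler_sum // => V _; rewrite rnorm_real normrM exprMn.
    rewrite (ger0_norm (word_weight_ge0 V)) ler_wpM2l ?sqr_ge0 //.
    by rewrite ler_pXn2r ?nnegrE ?word_coef_le.
  apply: le_trans (lerD h1 h2) _; have := sqr_ge0 (w x); rewrite exprMn; lra.
- move=> B; apply: le_trans (sum_single (x := phi) B _ _) _ => [phi'|phi' /negPf ->|] //.
    by case: ifP => // _; rewrite sqr_ge0.
  by rewrite eqxx.
move=> b2 le; split=> //.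
by rewrite -(@ler_pXn2r _ 2) ?nnegrE ?l2_norm_ge0 ?mulr_ge0 // sqr_l2_norm.
Qed.

Let D : set (index -> R[i]^o) := [set d | exists phi x, d = base_vec phi x].

Let D_l2 d : D d -> l2 d.
Proof. by move=> [phi [x ->]]; exact: (l2_base_vec phi x).1. Qed.

Let D_act v d : D d -> l2_span D (group_act v d).
Proof.
move=> [phi [x ->]]; rewrite group_act_base.
by apply: sub_l2_span => //; exists phi, (v * x)%g.
Qed.

Let act v : span_space D -> span_space D := span_lift (group_act v).

Let val_act v u : val (act v u) = group_act v (val u).
Proof. by apply: val_span_lift; [exact: group_act_bounded|exact: D_act]. Qed.

Let base (phi : G -> bool) (x : G) : span_space D.
Proof.
exists (base_vec phi x); apply/asboolP; apply: sub_l2_span => //.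
by exists phi, x.
Defined.

(** The test vector is the image of the point mass at the identity, the test functional the
    coordinate at the empty word: its constant is 1 and its coefficient functional is [+-w]
    itself. *)
Theorem weight_dichotomy_operator_algebra :
  isomorphic_to_operator_algebra (l1 w) (@convolution R G) (l1_norm w).
Proof.
have ab0 : 0 <= act_bound by rewrite (le_trans ler01) ?act_bound_ge1.
apply: (@group_action_operator_algebra R G w (span_hilbert D) w_gt0
  weight_submul act act_bound _ _ ab0 _ (fun phi => base phi 1%g)
  (fun phi (u : span_space D) => val u (phi, inr [::])) (2 * w 1%g)).
- move=> v a u u'; apply: val_inj; rewrite val_act !linearP /= !val_act.
  by apply: (group_act_bounded v).1; apply: span_spaceP2.
- move=> v v' u; apply: val_inj; rewrite !val_act.
  apply: (l2_span_ext (L := group_act v \o group_act v')) (span_spaceP u).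
  + by apply: l2_bounded_comp; apply: group_act_bounded.
  + exact: group_act_bounded.
  + by move=> _ [phi [x ->]]; rewrite /= !group_act_base mulgA.
- move=> v u; rewrite !span_rnormE val_act.
  exact: (l2_group_act v (span_spaceP2 u)).2.
- by rewrite mulr_ge0.
- by move=> phi; rewrite span_rnormE; exact: (l2_base_vec phi 1%g).2.
- by move=> phi a u u'; rewrite linearP.
- by move=> phi u; rewrite span_rnormE; apply: l2_coord; apply: span_spaceP2.
- move=> phi x; rewrite val_act /= group_act_base mulg1 /base_vec /= eqxx mul1r.
  by rewrite rmorphM /= rmorphXn /= rmorphN1.
Qed.

End Construction.

(** * Word length and exponential weights *)

Section WordLength.
Variables (R : realType) (G : groupType) (F : {fset G}).
Hypothesis genF : generates F.
Hypothesis symF : forall x, x \in F -> (x^-1)%g \in F.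
Hypothesis F1 : 1%g \in F.
Implicit Types (x y u v : G) (m n : nat).

Lemma fset_power0 x : (x \in fset_power F 0) = (x == 1%g).
Proof. by rewrite /fset_power /= inE. Qed.

Lemma fset_powerSP x n : reflect
  (exists2 u, u \in F & exists2 v, v \in fset_power F n & x = (u * v)%g)
  (x \in fset_power F n.+1).
Proof. exact: imfset2P. Qed.

Lemma fset_powerM x y m n : x \in fset_power F m -> y \in fset_power F n ->
  (x * y)%g \in fset_power F (m + n).
Proof.
elim: m x => [|m IH] x; first by rewrite fset_power0 => /eqP ->; rewrite mul1g.
case/fset_powerSP => u uF [v vF ->] yF; rewrite addSn -mulgA.
by apply/fset_powerSP; exists u => //; exists (v * y)%g => //; apply: IH.
Qed.

Lemma fset_power1 x : x \in F -> x \in fset_power F 1.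
Proof.
move=> xF; apply/fset_powerSP; exists x => //; exists 1%g; last by rewrite mulg1.
by rewrite fset_power0.
Qed.

Lemma fset_powerS x n : x \in fset_power F n -> x \in fset_power F n.+1.
Proof. by move=> xF; apply/fset_powerSP; exists 1%g => //; exists x; rewrite ?mul1g. Qed.

Lemma fset_power_le x m n : (m <= n)%N -> x \in fset_power F m -> x \in fset_power F n.
Proof.
move=> /subnK <- xF; elim: (n - m)%N => // k IH.
by rewrite addSn; apply: fset_powerS.
Qed.

Lemma fset_powerV x n : x \in fset_power F n -> (x^-1)%g \in fset_power F n.
Proof.
elim: n x => [|n IH] x; first by rewrite !fset_power0 => /eqP ->; rewrite invg1.
case/fset_powerSP => u uF [v vF ->]; rewrite invgM -addn1.
by apply: fset_powerM; [exact: IH|exact/fset_power1/symF].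
Qed.

Lemma fset_power_cover x : exists n, x \in fset_power F n.
Proof.
pose S : {pred G} := [pred x | `[< exists n, x \in fset_power F n >]].
suff : x \in S by move/asboolP.
apply: genF.
  split; first by apply/asboolP; exists 0%N; rewrite fset_power0.
  move=> u v /asboolP[m um] /asboolP[n vn]; apply/asboolP; exists (m + n)%N.
  exact: fset_powerM (fset_powerV vn).
by move=> u uF; apply/asboolP; exists 1%N; apply: fset_power1.
Qed.

Definition nat_length x : nat := ex_minn (fset_power_cover x).

Lemma nat_lengthP x n : (x \in fset_power F n) = (nat_length x <= n)%N.
Proof.
rewrite /nat_length; case: ex_minnP => m xm minm; apply/idP/idP; first exact: minm.
by move/fset_power_le; apply.
Qed.

Lemma nat_length0 x : (nat_length x == 0)%N = (x == 1%g).
Proof. by rewrite -leqn0 -nat_lengthP fset_power0. Qed.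

Lemma nat_lengthM x y : (nat_length (x * y)%g <= nat_length x + nat_length y)%N.
Proof. by rewrite -nat_lengthP fset_powerM // nat_lengthP. Qed.

Lemma word_lengthE x : word_length R F x = (nat_length x)%:R.
Proof.
rewrite /word_length; case: ifPn => [|x1].
  by rewrite -nat_length0 => /eqP ->.
set E := [set _ | _ in _].
have Ex : E (nat_length x)%:R.
  by exists (nat_length x) => //=; rewrite lt0n nat_length0 nat_lengthP.
have Elb : lbound E (nat_length x)%:R.
  by move=> _ [n [_ xn] <-]; rewrite ler_nat -nat_lengthP.
apply/eqP; rewrite eq_le ge_inf //=; last by exists (nat_length x)%:R.
by apply: lb_le_inf => //; exists (nat_length x)%:R.
Qed.

Lemma geodesic x n : x \in fset_power F n -> exists q : nat -> G,
  [/\ q 0 = 1%g, q n = x & forall i, (i < n)%N -> ((q i)^-1 * q i.+1)%g \in F].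
Proof.
elim: n x => [|n IH] x; first by rewrite fset_power0 => /eqP ->; exists (fun=> 1%g).
case/fset_powerSP => u uF [v /IH[q [q0 qn qS]] ->].
exists (fun i => if i is j.+1 then (u * q j)%g else 1%g); split=> //.
  by rewrite qn.
case=> [_|i lt]; first by rewrite q0 mulg1 invg1 mul1g.
by rewrite invgM -mulgA mulKg; apply: qS.
Qed.

(** Balls are finite, so an infinite group has elements of arbitrarily large length. Along a
    shortest word a segment is no longer than its number of letters, and a strictly shorter one
    would shorten the whole by the triangle inequality. *)
Lemma long_geodesic (n : nat) : infinite_set [set: G] -> exists q : nat -> G,
  forall i j, (i <= j <= n)%N -> nat_length ((q i)^-1 * q j)%g = (j - i)%N.
Proof.
move=> infG; have [x lx] : exists x, (n <= nat_length x)%N.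
  apply: contrapT => nx; apply: infG; apply: (@sub_finite_set _ _ [set` fset_power F n]) => //.
  move=> x _ /=; rewrite nat_lengthP leqNgt; apply/negP => lt.
  by apply: nx; exists x; apply: ltnW.
have [|q [q0 qn qS]] := @geodesic x (nat_length x); first by rewrite nat_lengthP.
have lip i j : (i <= j <= nat_length x)%N -> (nat_length ((q i)^-1 * q j)%g <= j - i)%N.
  move=> /andP[ij jx]; rewrite -{1}(subnKC ij); move: jx; rewrite -{1}(subnKC ij).
  elim: (j - i)%N => [|d IH] le; first by rewrite addn0 mulVg leqn0 nat_length0.
  have -> : ((q i)^-1 * q (i + d.+1)%N =
             (q i)^-1 * q (i + d)%N * ((q (i + d)%N)^-1 * q (i + d)%N.+1))%g.
    by rewrite addnS mulgA mulgK.
  apply: leq_trans (nat_lengthM _ _) _; rewrite -[d.+1]addn1 leq_add //.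
    by apply: IH; apply: leq_trans le; rewrite leq_add2l.
  by rewrite -nat_lengthP; apply/fset_power1/qS; rewrite -addnS.
exists q => i j /andP[ij jn]; have jx := leq_trans jn lx.
apply/eqP; rewrite eqn_leq lip ?ij //=.
have h1 := lip 0%N i; rewrite q0 invg1 mul1g subn0 (leq_trans ij jx) in h1.
have h2 := lip j (nat_length x); rewrite jx leqnn qn in h2.
have E : (q i * ((q i)^-1 * q j) * ((q j)^-1 * x) = x)%g by rewrite mulVKg mulVKg.
have := nat_lengthM (q i * ((q i)^-1 * q j))%g ((q j)^-1 * x)%g.
have := nat_lengthM (q i) ((q i)^-1 * q j)%g.
rewrite E; move: (h1 isT) (h2 isT); lia.
Qed.

(** A geodesic is cut at its point [m]: [x i] covers the last [i] steps before the cut, [y j] the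
    first [j * m] steps after it, so lengths add. The steps of size [m] make the lengths
    [i + j * m], [i < m], pairwise distinct, hence the products too. *)
Lemma geodesic_rectangle (m n : nat) : infinite_set [set: G] ->
  exists x y : nat -> G, forall i j, (i < m)%N -> (j < n)%N ->
    [/\ nat_length (x i) = i, nat_length (y j) = (j * m)%N &
        nat_length (x i * y j)%g = (i + j * m)%N].
Proof.
move=> infG; have [q hq] := long_geodesic (m + n * m) infG.
exists (fun i => (q (m - i)%N)^-1 * q m)%g, (fun j => (q m)^-1 * q (m + j * m)%N)%g.
move=> i j im jn; have jm : (j * m <= n * m)%N by rewrite leq_mul2r ltnW ?orbT.
rewrite -mulgA mulVKg !hq; first by split; lia.
all: by apply/andP; split; lia.
Qed.

End WordLength.

(** * Subadditivity of powers with a gap *)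

Lemma powR_bernoulli (R : realType) (a r : R) : 0 < a < 1 -> 0 <= r ->
  (1 + r) `^ a <= 1 + a * r.
Proof.
move=> /andP[a0 a1] r0.
have u0 : 0 < 1 + r by rewrite ltr_wpDr.
have m0 : 0 < 1 + a * r by rewrite ltr_wpDr // mulr_ge0 // ltW.
rewrite -ler_ln ?posrE ?powR_gt0 // ln_powR.
(* The tangent bound for [ln] at [1 + a r], the mean of [1] and [1 + r] with weights [1 - a] and
   [a]; the two weighted bounds add up to zero. *)
have h z : 0 < z -> ln (z / (1 + a * r)) <= z / (1 + a * r) - 1.
  move=> z0; rewrite -{1}(subrKC 1 (z / _)); apply: le_ln1Dx.
  by rewrite ltrBrDl subrr divr_gt0.
have := h _ u0; have := h _ (@ltr01 R).
rewrite !ln_div ?posrE // ln1 => h1 h2.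
have {h1}h1 := ler_wpM2l (_ : 0 <= 1 - a) h1; have {h2}h2 := ler_wpM2l (ltW a0) h2.
have := lerD (h1 _) h2; rewrite subr_ge0 ltW // => /(_ isT).
have -> : (1 - a) * (1 / (1 + a * r) - 1) + a * ((1 + r) / (1 + a * r) - 1) = 0.
  by field; rewrite gt_eqF.
lra.
Qed.

(** After scaling to [s = t r] with [0 <= r <= 1], Bernoulli gives [(1 + r)^a <= 1 + a r], and
    [r <= r^a]. *)
Lemma powR_subadditive_gap (R : realType) (a s t : R) : 0 < a < 1 ->
  0 <= s -> s <= t -> (s + t) `^ a <= t `^ a + a * s `^ a.
Proof.
move=> a01 s0 st; have /andP[a0 a1] := a01.
have [t0|tn0] := eqVneq t 0.
  have -> : s = 0 by apply/eqP; rewrite eq_le s0 -{1}t0 st.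
  by rewrite t0 addr0 powR0 ?gt_eqF // mulr0 addr0.
have tp : 0 < t by rewrite lt_def tn0 (le_trans s0).
have [r [r0 r1 ->]] : exists r, [/\ 0 <= r, r <= 1 & s = t * r].
  exists (s / t); split; first by rewrite divr_ge0 // ltW.
    by rewrite ler_pdivrMr // mul1r.
  by field.
have -> : t * r + t = t * (1 + r) by ring.
rewrite (powRM _ (ltW tp) (addr_ge0 ler01 r0)) (powRM _ (ltW tp) r0).
rewrite mulrCA -[X in _ <= X + _]mulr1 -mulrDr ler_wpM2l ?powR_ge0 //.
rewrite (le_trans (powR_bernoulli a01 r0)) // lerD2l (ler_wpM2l (ltW a0)) //.
have [->|rn0] := eqVneq r 0; first exact: powR_ge0.
rewrite -[leLHS]powRr1 //; apply: ger_powR; last exact: ltW.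
by rewrite lt_def rn0 r0.
Qed.

(** The right side equals [C (s + a t)], written so that the gain [C (1 - a) t] is visibly the
    exponent of a square. *)
Lemma exponent_gap (R : realFieldType) (C a l s t : R) : 0 <= C ->
  l <= s + a * t -> C * l <= 2%:R * - (C * (1 - a) / 2 * t) + (C * s + C * t).
Proof.
move=> C0 le; apply: le_trans (ler_wpM2l C0 le) _.
by rewrite le_eqVlt; apply/orP; left; apply/eqP; field.
Qed.

(** * Summability from polynomial growth *)

Section Growth.
Variable R : realType.

Lemma horner_le_power (p : {poly R}) : exists (B : R) (d : nat), 0 <= B /\
  forall n : nat, p.[n%:R] <= B * n.+1%:R ^+ d.
Proof.
exists (\sum_(i < size p) `|p`_i|), (size p); split; first by apply: sumr_ge0.
move=> n; rewrite horner_coef mulr_suml; apply: ler_sum => i _.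
apply: le_trans (ler_norm _) _; rewrite normrM normrX normr_nat ler_wpM2l //.
apply: (@le_trans _ _ (n.+1%:R ^+ i)).
  by rewrite lerXn2r ?nnegrE ?ler0n // ler_nat.
by apply: ler_weXn2l; [rewrite ler1n|exact: ltnW].
Qed.

Lemma power_expR_bounded (a b : R) (m : nat) : 0 < a -> 0 < b ->
  exists2 D : R, 0 <= D & forall n : nat, n.+1%:R ^+ m * expR (- (b * n%:R `^ a)) <= D.
Proof.
(* With [k >= m / a] and [t = (n + 1)^a], [(n + 1)^m <= t^k], while [(b t / k)^k <= e^(b t)] follows
   from [1 + z <= e^z]. *)
move=> a0 b0; pose k := (Num.bound (m%:R / a)).+1.
have kam : m%:R <= a * k%:R.
  rewrite mulrC -ler_pdivrMr //; apply: ltW.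
  apply: lt_trans (archi_boundP (divr_ge0 (ler0n _ m) (ltW a0))) _.
  by rewrite ltr_nat.
have bk : 0 < b / k%:R by rewrite divr_gt0 // ltr0n.
exists (2 ^+ m * (b / k%:R) ^- k + 1).
  by rewrite addr_ge0 // mulr_ge0 ?exprn_ge0 // invr_ge0 exprn_ge0 // ltW.
(* The value 0 is treated apart, since [n + 1 <= 2 n] fails there; the summand 1 of the bound is for
   it. *)
case=> [|n].
  rewrite expr1n mul1r; apply: (@le_trans _ _ 1); last first.
    by rewrite lerDr mulr_ge0 ?exprn_ge0 // invr_ge0 exprn_ge0 // ltW.
  by rewrite expR_le1 oppr_le0 mulr_ge0 ?powR_ge0 ?ltW.
apply: (@le_trans _ _ (2 ^+ m * (b / k%:R) ^- k)); last by rewrite lerDl.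
set t := n.+1%:R `^ a; have t0 : 0 <= t by apply: powR_ge0.
rewrite expRN ler_pdivrMr ?expR_gt0 //.
have h1 : n.+2%:R ^+ m <= 2 ^+ m * n.+1%:R ^+ m :> R.
  rewrite -exprMn lerXn2r ?nnegrE ?mulr_ge0 ?ler0n // -natrM ler_nat; lia.
have h2 : n.+1%:R ^+ m <= t ^+ k.
  rewrite -powR_mulrn ?ler0n // -powR_mulrn // /t -powRrM.
  by apply: ler_powR => //; rewrite ler1n.
have h3 : (b / k%:R * t) ^+ k <= expR (b * t).
  have -> : b * t = k%:R * (b / k%:R * t) by field; rewrite pnatr_eq0.
  have bt0 : 0 <= b / k%:R * t by rewrite mulr_ge0 // ltW.
  rewrite expRM_natl lerXn2r ?nnegrE ?expR_ge0 //.
  by apply: le_trans (expR_ge1Dx _); rewrite lerDr.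
apply: (le_trans h1); rewrite -mulrA ler_wpM2l ?exprn_ge0 //.
apply: (le_trans h2); rewrite mulrC ler_pdivlMr ?exprn_gt0 //.
by rewrite -exprMn mulrC.
Qed.

Lemma sum_inv_quadratic (n : nat) :
  \sum_(i < n) ((i.+1 * i.+2)%:R)^-1 <= 1 :> R.
Proof.
suff -> : \sum_(i < n) ((i.+1 * i.+2)%:R)^-1 = 1 - (n.+1%:R)^-1 :> R.
  by rewrite gerBl invr_ge0 ler0n.
elim: n => [|n IH]; first by rewrite big_ord0 invr1 subrr.
rewrite big_ord_recr /= IH natrM.
have n1 : n.+1%:R != 0 :> R by rewrite pnatr_eq0.
have n2 : n.+2%:R != 0 :> R by rewrite pnatr_eq0.
have e : n.+2%:R = n.+1%:R + 1 :> R by rewrite -natr1.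
rewrite e in n2 *; move: (n.+1%:R) n1 n2 {IH e} => z n1 n2.
by field; rewrite n1 n2.
Qed.

(** At most [B (n + 1)^d] elements have length [n]. The exponential absorbs two further powers of
    [n + 1], and [(n + 1) (n + 2) <= 2 (n + 1)^2] leaves a telescoping series, whence the constant
    [2 * D]. *)
Lemma growth_summable (G : choiceType) (len : G -> nat) (balls : nat -> {fset G})
    (p : {poly R}) (a b : R) :
  (forall x n, (len x <= n)%N -> x \in balls n) ->
  (forall n, (#|` balls n|)%:R <= p.[n%:R]) -> 0 < a -> 0 < b ->
  exists K : R, forall A : {fset G},
    \sum_(x <- A) expR (- (b * (len x)%:R `^ a)) <= K.
Proof.
move=> hballs hp a0 b0; have [B [d [B0 hB]]] := horner_le_power p.
have [D D0 hD] := power_expR_bounded (d + 2) a0 b0.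
exists (B * (2 * D)) => A; pose N := (\max_(x <- A) len x).+1.
pose g (n : nat) := expR (- (b * n%:R `^ a)).
have g0 n : 0 <= g n by apply: expR_ge0.
apply: (@le_trans _ _ (\sum_(n < N) B * n.+1%:R ^+ d * g n)).
  have -> : \sum_(x <- A) expR (- (b * (len x)%:R `^ a)) =
      \sum_(x <- A) \sum_(n < N | len x == n :> nat) g n.
    rewrite big_seq [RHS]big_seq; apply: eq_bigr => x xA.
    have xN : (len x < N)%N by rewrite ltnS; apply: (leq_bigmax_seq (F := len)).
    by rewrite (big_pred1 (Ordinal xN)).
  rewrite (exchange_big_dep xpredT) //=; apply: ler_sum => n _.
  rewrite -big_filter big_const_seq count_predT iter_addr_0 -[leLHS]mulr_natl ler_wpM2r //.
  apply: le_trans (hB n); apply: le_trans (hp n); rewrite ler_nat.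
  rewrite cardfE -[leqRHS]cardfE.
  apply: uniq_leq_size; first by rewrite filter_uniq // fset_uniq.
  by move=> x; rewrite mem_filter => /andP[/eqP xn _]; apply: hballs; rewrite xn.
have -> : B * (2 * D) = B * (2 * D) * 1 by rewrite mulr1.
apply: le_trans (ler_wpM2l _ (sum_inv_quadratic N)); last by rewrite !mulr_ge0.
rewrite mulr_sumr; apply: ler_sum => n _.
rewrite -!mulrA ler_wpM2l // mulrA ler_pdivlMr ?ltr0n ?muln_gt0 //.
apply: (@le_trans _ _ (n.+1%:R ^+ d * g n * (2 * n.+1%:R ^+ 2))).
  rewrite ler_wpM2l ?mulr_ge0 ?exprn_ge0 //.
  by rewrite expr2 mulrA -!natrM ler_nat; lia.
by have := hD n; rewrite exprD /g; lra.
Qed.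

End Growth.

Theorem exp_weight_operator_algebra (R : realType) (G : groupType) (F : {fset G})
    (alpha C : R) :
  generates F -> (forall x, x \in F -> (x^-1)%g \in F) -> 1%g \in F ->
  polynomial_growth R F -> 0 < alpha < 1 -> 0 < C ->
  let w := exp_weight F alpha C in
  isomorphic_to_operator_algebra (l1 w) (@convolution R G) (l1_norm w).
Proof.
move=> genF symF F1 [p hp] a01 C0 w; have /andP[a0 a1] := a01.
pose len := nat_length genF symF.
pose L x : R := (len x)%:R `^ alpha.
have wE x : w x = expR (C * L x) by rewrite /w /exp_weight (word_lengthE _ genF symF F1).
(* Half of the gap, so that [h x ^+ 2] is the whole factor gained when [x] is not longer than
   [v]. *)
pose beta := C * (1 - alpha) / 2.
have beta0 : 0 < beta by rewrite divr_gt0 // mulr_gt0 // subr_gt0.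
have betaC : beta <= C.
  by rewrite /beta -mulrA ler_piMr ?ltW //; lra.
pose h x := expR (- (beta * L x)).
have L0 x : 0 <= L x by apply: powR_ge0.
have lenle v x : L (v * x)%g <= ((len v)%:R + (len x)%:R) `^ alpha.
  rewrite -natrD; apply: ge0_ler_powR; rewrite ?nnegrE ?ler0n ?(ltW a0) //.
  by rewrite ler_nat nat_lengthM.
have Lgap v x : L (v * x)%g <= L v + alpha * L x /\ (len x <= len v)%N \/
                L (v * x)%g <= L x + alpha * L v.
  case: (leqP (len x) (len v)) => le; [left; split=> //|right];
    apply: le_trans (lenle v x) _.
    by rewrite addrC powR_subadditive_gap ?ler0n ?ler_nat.
  by rewrite powR_subadditive_gap ?ler0n ?ler_nat // ltnW.
have Lsub v x : L (v * x)%g <= L v + L x.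
  case: (Lgap v x) => [[le _]|le]; apply: le_trans le _; last rewrite [leRHS]addrC;
    by rewrite lerD2l ler_piMl // ltW.
have [K hK] := @growth_summable R G len (fset_power F) p alpha (2 * beta)
  (fun x n le => etrans (nat_lengthP genF symF F1 x n) le) hp a0
  (mulr_gt0 (ltr0n _ 2) beta0).
have K0 : 0 <= K by have := hK fset0; rewrite big_seq_fset0.
(* With this choice [eps^2 K <= 2^-1] amounts to [K <= 2 (K + 1)^2]. *)
pose eps := (2 * (K + 1))^-1.
have eps0 : 0 < eps by rewrite invr_gt0 mulr_gt0 // ltr_wpDl.
have h_sum (A : {fset G}) : \sum_(x <- A) h x ^+ 2 <= K.
  apply: le_trans (hK A); apply: ler_sum => x _.
  by rewrite /h -expRM_natl mulrN mulrA.
clear hK; clearbody w; clearbody L.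
apply: (@weight_dichotomy_operator_algebra R G w h K eps) => //.
- by move=> x; rewrite wE expR_gt0.
- by move=> x; rewrite expR_gt0.
- by move=> x; rewrite expR_le1 oppr_le0 mulr_ge0 // ltW.
(* The product [h * w] is the exponential weight with constant [C - beta >= 0], hence
   submultiplicative, and its value at [v] is at most [w v]. *)
- move=> v x; rewrite !wE /h -!expRD ler_expR.
  have Cb : 0 <= C - beta by rewrite subr_ge0.
  have := ler_wpM2l Cb (Lsub v x); have := mulr_ge0 (ltW beta0) (L0 v); lra.
- move=> v x; rewrite !wE /h -expRM_natl -!expRD !ler_expR.
  case: (Lgap v x) => [[le _]|le]; [left|right].
    exact: exponent_gap (ltW C0) le.
  (* The gap yields [h v ^+ 2] here; one factor is given up. *)
  have bL : beta * L v <= 2%:R * (beta * L v).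
    by rewrite mulr_natl mulr2n lerDl (mulr_ge0 (ltW beta0) (L0 v)).
  apply: le_trans (exponent_gap (ltW C0) le) _.
  by rewrite mulrN [C * L x + _]addrC lerD2r lerN2.
- rewrite /eps exprVn mulrC ler_pdivrMr ?exprn_gt0 ?mulr_gt0 ?ltr_wpDl //.
  have := sqr_ge0 K; lra.
Qed.

(** * The obstruction from sign matrices *)

(** Flipping the sign at [j] permutes the sign vectors and negates every term, so the sum equals its
    opposite. *)
Lemma sum_signs_eq0 (R : numDomainType) (n : nat) (j k : 'I_n) : j != k ->
  \sum_(e : {ffun 'I_n -> bool}) (-1) ^+ e j * (-1) ^+ e k = 0 :> R.
Proof.
move=> jk; pose flip (e : {ffun 'I_n -> bool}) : {ffun 'I_n -> bool} :=
  [ffun l => if l == j then ~~ e l else e l].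
have flipK : involutive flip.
  by move=> e; apply/ffunP => l; rewrite !ffunE; case: eqP => // _; rewrite negbK.
set S := LHS; suff SN : S = - S.
  apply/eqP; rewrite -[S == 0]/(false || (S == 0)) -(mulrn_eq0 S 2).
  by rewrite mulr2n {2}SN subrr.
rewrite {1}/S (reindex_inj (inv_inj flipK)) /= -sumrN; apply: eq_bigr => e _.
rewrite !ffunE eqxx eq_sym (negPf jk) -mulNr; congr (_ * _).
by case: (e j); rewrite /= ?expr0 ?expr1 ?opprK.
Qed.

(** The cross terms cancel by [sum_signs_eq0], which makes this the parallelogram law for [n]
    vectors. It is where the obstruction uses that the norm is Hilbertian. *)
Lemma sum_signs_norm (R : realType) (H : hilbertSpace R) (n : nat) (v : 'I_n -> H) :
  \sum_(e : {ffun 'I_n -> bool}) rnorm (\sum_j ((-1) ^+ e j : R[i]) *: v j) ^+ 2 =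
  #|{ffun 'I_n -> bool}|%:R * \sum_j rnorm (v j) ^+ 2.
Proof.
have nE (u : H) : (rnorm u ^+ 2)%:C = inner H u u.
  by rewrite -inner_norm rnormE rmorphXn.
have innerZl (a : R[i]) (u u' : H) : inner H (a *: u) u' = a * inner H u u'.
  exact: (linearZl_LR (inner H)).
have innerZr (a : R[i]) (u u' : H) : inner H u (a *: u') = Num.conj a * inner H u u'.
  exact: (linearZr_LR (inner H)).
have inner_suml (f : 'I_n -> H) u : inner H (\sum_j f j) u = \sum_j inner H (f j) u.
  exact: (linear_sumlz (inner H)).
have inner_sumr (f : 'I_n -> H) u : inner H u (\sum_j f j) = \sum_j inner H u (f j).
  exact: (linear_sumr (inner H)).
have sgn (e : {ffun 'I_n -> bool}) j : Num.conj ((-1) ^+ e j : R[i]) = (-1) ^+ e j.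
  by rewrite rmorphXn /= rmorphN1.
have expand (e : {ffun 'I_n -> bool}) :
    (rnorm (\sum_j ((-1) ^+ e j : R[i]) *: v j) ^+ 2)%:C =
    \sum_j \sum_k (-1) ^+ e j * (-1) ^+ e k * inner H (v j) (v k).
  rewrite nE inner_suml; apply: eq_bigr => j _.
  rewrite inner_sumr; apply: eq_bigr => k _.
  by rewrite innerZl innerZr sgn mulrA.
apply: complexI; rewrite rmorph_sum rmorphM /= rmorph_sum rmorph_nat /=.
under eq_bigr => e _ do rewrite expand.
rewrite exchange_big /= mulr_sumr; apply: eq_bigr => j _.
rewrite exchange_big /= (bigD1 j) //= [X in _ + X]big1 ?addr0 => [|k kj].
  rewrite -mulr_suml; under eq_bigr => e _ do rewrite -expr2 sqrr_sign.
  by rewrite sumr_const nE.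
by rewrite -mulr_suml sum_signs_eq0 ?mul0r // eq_sym.
Qed.

Lemma sum_sqr_le (R : realType) (T : finType) (a : T -> R) :
  (\sum_e a e) ^+ 2 <= #|T|%:R * \sum_e a e ^+ 2.
Proof.
have := CauchySchwarz_seq (fun=> 1) a (index_enum T).
under eq_bigr do rewrite mul1r.
by under [X in _ <= X * _]eq_bigr do rewrite expr1n; rewrite sumr_const.
Qed.

Section NotOperatorAlgebra.
Variables (R : realType) (G : groupType) (w : G -> R) (K : R).
Hypothesis w_gt0 : forall x, 0 < w x.
Hypothesis K_gt0 : 0 < K.
Hypothesis grids : forall P N : nat, exists x y : nat -> G,
  (forall i j i' j', (i < P)%N -> (j < N)%N -> (i' < P)%N -> (j' < N)%N ->
     (x i * y j = x i' * y j')%g -> i = i' /\ j = j') /\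
  (forall i j, (i < P)%N -> (j < N)%N -> w (x i) * w (y j) <= K * w (x i * y j)%g).

Lemma l1_finite_comb (T : finType) (z : T -> G) (c : T -> R[i]) :
  l1 w (\sum_p c p *: dirac_fun R (z p) : G -> R[i]^o).
Proof.
apply: (@big_ind _ (l1 w)) => [|f g f1 g1|p _].
- exact: l1_0.
- by rewrite -[f]scale1r; apply: (l1_lin w_gt0 1 f1 g1).1.
- rewrite -[_ *: _]addr0.
  exact: (l1_lin w_gt0 (c p) (l1_dirac w_gt0 (z p)).1 (l1_0 w_gt0)).1.
Qed.

Lemma l1_norm_finite_comb (T : finType) (z : T -> G) (c : T -> R[i]) : injective z ->
  \sum_p rnorm (c p) * w (z p) <=
  l1_norm w (\sum_p c p *: dirac_fun R (z p) : G -> R[i]^o).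
Proof.
move=> zi; set f : G -> R[i]^o := \sum_p _.
have fz p : f (z p) = c p.
  rewrite /f fct_sumE (bigD1 p) //= big1 ?addr0 => [|p' p'p].
    by rewrite -[LHS]/(c p * (z p == z p)%:R) eqxx mulr1.
  by rewrite -[LHS]/(c p' * (z p == z p')%:R) (inj_eq zi) eq_sym (negPf p'p) mulr0.
have := l1_fset_le w_gt0 (seq_fset tt (map z (index_enum T))) (l1_finite_comb z c).
rewrite (perm_big _ (seq_fset_perm _ _)) undup_id ?map_inj_uniq ?index_enum_uniq //.
rewrite big_map; apply: le_trans; rewrite -/f.
by apply: ler_sum => p _; rewrite fz.
Qed.

Lemma not_operator_algebra :
  ~ isomorphic_to_operator_algebra (l1 w) (@convolution R G) (l1_norm w).
Proof.
move=> [H [A [Phi [[Abd _ _ _] [Phi_in _ _] Phi_lin Phi_mul [[M hM] [M' hM']]]]]].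
have bd f : l1 w f -> bounded_operator (Phi f) by move=> f1; apply/Abd/Phi_in.
pose M1 := `|M| + 1; have M1_gt0 : 0 < M1 by rewrite ltr_wpDl.
have Phi_dirac x u : rnorm (Phi (dirac_fun R x) u) <= M1 * w x * rnorm u.
  have [d1 dle] := l1_dirac w_gt0 x.
  apply: le_trans (le_opnorm u (bd _ d1)) _; rewrite ler_wpM2r ?rnorm_ge0 //.
  apply: le_trans (hM _ d1) _; apply: le_trans (ler_wpM2l (ltW M1_gt0) dle).
  by rewrite ler_wpM2r ?l1_norm_ge0 // (le_trans (ler_norm _)) // lerDl.
pose M1' := `|M'| + 1; have M1'_gt0 : 0 < M1' by rewrite ltr_wpDl.
have Phi0 : Phi 0 = 0.
  have := Phi_lin 1 0 0 (l1_0 w_gt0) (l1_0 w_gt0); rewrite !scale1r addr0 => /eqP.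
  by rewrite -subr_eq subrr eq_sym => /eqP.
have Phi_comb (T : finType) (z : T -> G) (c : T -> R[i]) :
    Phi (\sum_p c p *: dirac_fun R (z p)) = \sum_p c p *: Phi (dirac_fun R (z p)).
  suff [] : l1 w (\sum_p c p *: dirac_fun R (z p) : G -> R[i]^o) /\
      Phi (\sum_p c p *: dirac_fun R (z p)) = \sum_p c p *: Phi (dirac_fun R (z p)) by [].
  apply: (big_ind2 (fun f S => l1 w f /\ Phi f = S)) => [|f S g S' [f1 fS] [g1 gS]|p _].
  - by split=> //; exact: l1_0.
  - rewrite -[f]scale1r -[S]scale1r; split; first exact: (l1_lin w_gt0 1 f1 g1).1.
    by rewrite Phi_lin // fS gS.
  - have d1 := (l1_dirac w_gt0 (z p)).1.
    have := Phi_lin (c p) _ 0 d1 (l1_0 w_gt0); rewrite Phi0 !addr0 => ->; split=> //.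
    by have := (l1_lin w_gt0 (c p) d1 (l1_0 w_gt0)).1; rewrite addr0.
have scale_bound (a p m r : R) : a * (p * m * (a * r)) = a ^+ 2 * p * m * r by ring.
have scale_compare (a p m k q : R) :
    a * (q ^+ 2 * p * m) * k = p * m * (k * a * q ^+ 2) by ring.
(* [N] is a square so that [sqrt N = n], and [n] exceeds the product of all constants, which the
   final estimate contradicts. *)
pose n := (Num.bound (K * M1' * M1 ^+ 2)).+1; pose N := (n ^ 2)%N.
pose T : finType := {ffun 'I_N -> bool}; pose P := #|T|.
have P_gt0 : (0 < P)%N by rewrite /P card_ffun card_bool expn_gt0.
have [x [y [xy_inj xy_le]]] := grids P N.
pose X (e : T) := x (enum_rank e); pose Y (j : 'I_N) := y j.
pose z (p : T * 'I_N) := (X p.1 * Y p.2)%g.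
have zi : injective z.
  move=> [e j] [e' j'] /xy_inj []; rewrite ?ltn_ord // => ee jj.
  by congr (_, _); [apply/enum_rank_inj/val_inj|apply/val_inj].
pose c (p : T * 'I_N) : R[i] :=
  (-1) ^+ p.1 p.2 * ((w (X p.1))^-1 * (w (Y p.2))^-1)%:C.
pose f : G -> R[i]^o := \sum_p c p *: dirac_fun R (z p).
have f1 : l1 w f by apply: l1_finite_comb.
have lower : (P * N)%:R / K <= l1_norm w f.
  apply: le_trans (l1_norm_finite_comb c zi).
  have -> : (P * N)%:R / K = \sum_(p : T * 'I_N) K^-1.
    by rewrite sumr_const card_prod card_ord mulr_natl.
  apply: ler_sum => -[e j] _; rewrite /c /z /= rnormM rnorm_real.
  have -> : rnorm ((-1) ^+ e j : R[i]) = 1 by rewrite /rnorm normrX normrN1 expr1n.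
  have X0 := w_gt0 (X e); have Y0 := w_gt0 (Y j).
  rewrite mul1r gtr0_norm ?mulr_gt0 ?invr_gt0 // -invfM [leRHS]mulrC.
  rewrite ler_pdivlMr ?mulr_gt0 // ler_pdivrMl //.
  exact: xy_le.
have upper : opnorm (Phi f) <= M1 ^+ 2 * P%:R * n%:R.
  apply: opnorm_le => [|u]; first by rewrite !mulr_ge0 // ltW.
  pose v (j : 'I_N) : H := ((w (Y j))^-1)%:C *: Phi (dirac_fun R (Y j)) u.
  pose g (e : T) : H := \sum_j ((-1) ^+ e j : R[i]) *: v j.
  have v_le j : rnorm (v j) <= M1 * rnorm u.
    rewrite rnormZ rnorm_real gtr0_norm ?invr_gt0 // ler_pdivrMl //.
    by rewrite mulrA [w _ * _]mulrC; apply: Phi_dirac.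
  have fE : Phi f u = \sum_(e : T) ((w (X e))^-1)%:C *: Phi (dirac_fun R (X e)) (g e).
    rewrite /f Phi_comb fct_sumE.
    have sumE e : Phi (dirac_fun R (X e)) (g e) =
        \sum_j ((-1) ^+ e j : R[i]) *: Phi (dirac_fun R (X e)) (v j).
      have be := bd _ (l1_dirac w_gt0 (X e)).1.
      have addE a b : Phi (dirac_fun R (X e)) (a + b) =
          Phi (dirac_fun R (X e)) a + Phi (dirac_fun R (X e)) b.
        by have := be.1 1 a b; rewrite !scale1r.
      rewrite /g (big_morph _ addE (bounded_operator0 be)).
      by apply: eq_bigr => j _; rewrite (bounded_operatorZ _ _ be).
    under [RHS]eq_bigr => e _ do rewrite sumE scaler_sumr.
    rewrite [RHS]pair_big /=; apply: eq_bigr => -[e j] _ /=.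
    have bj := bd _ (l1_dirac w_gt0 (X e)).1.
    rewrite /v (bounded_operatorZ _ _ bj) !scalerA.
    have dx := (l1_dirac w_gt0 (X e)).1; have dy := (l1_dirac w_gt0 (Y j)).1.
    rewrite -[(_ *: Phi _) u]/(c (e, j) *: Phi (dirac_fun R (z (e, j))) u).
    rewrite /z /= -convolution_dirac2 Phi_mul //=; congr (_ *: _).
    by rewrite /c /= rmorphM /= mulrCA mulrA.
  have le1 : rnorm (Phi f u) <= M1 * \sum_e rnorm (g e).
    rewrite fE mulr_sumr; apply: le_trans (ler_rnorm_sum _ _) _.
    apply: ler_sum => e _; rewrite rnormZ rnorm_real gtr0_norm ?invr_gt0 //.
    rewrite ler_pdivrMl // mulrA [w _ * _]mulrC; exact: Phi_dirac.
  (* Cauchy-Schwarz over the [P] sign vectors gives one factor [P], [sum_signs_norm] the other, and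
     the [N = n^2] vectors [v j] have norm at most [M1 * rnorm u]. *)
  have le2 : (\sum_e rnorm (g e)) ^+ 2 <= (P%:R * n%:R * (M1 * rnorm u)) ^+ 2.
    apply: le_trans (sum_sqr_le _) _; rewrite -/P.
    have := sum_signs_norm v; rewrite -/P => ->.
    rewrite mulrA -expr2 -mulrA exprMn ler_wpM2l ?sqr_ge0 //.
    apply: (@le_trans _ _ (\sum_(j < N) (M1 * rnorm u) ^+ 2)).
      apply: ler_sum => j _.
      by rewrite lerXn2r ?nnegrE ?rnorm_ge0 ?mulr_ge0 ?rnorm_ge0 ?v_le ?ltW.
    have N2 : N%:R = n%:R ^+ 2 :> R by rewrite /N natrX.
    by rewrite sumr_const card_ord -[leLHS]mulr_natl N2 -exprMn.
  have s0 : 0 <= \sum_e rnorm (g e) by apply: sumr_ge0 => e _; exact: rnorm_ge0.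
  have t0 : 0 <= P%:R * n%:R * (M1 * rnorm u).
    by rewrite !mulr_ge0 ?ler0n ?rnorm_ge0 // ltW.
  rewrite ler_pXn2r ?nnegrE // in le2.
  apply: le_trans le1 _; apply: le_trans (ler_wpM2l (ltW M1_gt0) le2) _.
  by rewrite scale_bound.
have bf := bd _ f1.
have : (P * N)%:R / K <= M1' * (M1 ^+ 2 * P%:R * n%:R).
  apply: le_trans lower _; apply: le_trans (hM' _ f1) _.
  apply: le_trans (ler_wpM2l (ltW M1'_gt0) upper).
  by rewrite ler_wpM2r ?opnorm_ge0 // (le_trans (ler_norm _)) // lerDl.
rewrite ler_pdivrMr // natrM /N natrX expr2 => le.
have Pn0 : 0 < P%:R * n%:R :> R by rewrite mulr_gt0 ?ltr0n.
have : n%:R <= K * M1' * M1 ^+ 2.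
  rewrite -(ler_pM2l Pn0); apply: le_trans (_ : _ <= P%:R * (n%:R * n%:R)) _.
    by rewrite mulrA.
  by apply: le_trans le _; rewrite scale_compare.
apply/negP; rewrite -ltNge; apply: lt_trans (archi_boundP _) _.
  by rewrite !mulr_ge0 ?sqr_ge0 // ltW.
by rewrite ltr_nat.
Qed.

End NotOperatorAlgebra.

(** * The endpoint exponents and the equivalence *)

Theorem theorem3p5 (R : realType) (G : groupType) (F : {fset G})
    (alpha C : R)
    (infG : infinite_set [set: G])
    (genF : generates F)
    (symF : forall x, x \in F -> (x^-1)%g \in F)
    (F1 : 1%g \in F)
    (growth : polynomial_growth R F)
    (alpha01 : 0 <= alpha <= 1)
    (C_gt0 : 0 < C) :
  let w := exp_weight F alpha C in
  isomorphic_to_operator_algebra (l1 w) (@convolution R G) (l1_norm w)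
  <-> 0 < alpha < 1.
Proof.
move=> w; split=> [iso|a01]; last exact: exp_weight_operator_algebra.
have w_gt0 x : 0 < w x by apply: expR_gt0.
apply: contrapT => nlt.
have alphaE : alpha = 0 \/ alpha = 1.
  have /andP[] := alpha01; rewrite !le_eqVlt.
  move=> /predU1P[<-|a0]; first by left.
  by move=> /predU1P[->|a1]; [right|case: nlt; rewrite a0].
pose len := nat_length genF symF.
(* For [alpha = 0] the weight is the constant [expR C], which serves as [K]; for [alpha = 1] it is
   multiplicative whenever lengths add, and [K = 1]. *)
have [K K_gt0 wK] : exists2 K : R, 0 < K & forall x y,
    len (x * y)%g = (len x + len y)%N -> w x * w y <= K * w (x * y)%g.
  case: alphaE => alphaE.
    exists (expR C); first exact: expR_gt0.
    by move=> x y _; rewrite /w /exp_weight alphaE !powRr0 mulr1.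
  have wE x : w x = expR (C * (len x)%:R).
    by rewrite /w /exp_weight alphaE (word_lengthE R genF symF F1) powRr1.
  exists 1 => [|x y lenxy]; first exact: ltr01.
  rewrite mul1r !wE lenxy.
  by rewrite (natrD R (len x) (len y)) (mulrDr C) expRD.
apply: (not_operator_algebra w_gt0 K_gt0 _ iso) => P N.
have [x [y xy]] := geodesic_rectangle genF symF F1 P N infG.
exists x, y; split=> [i j i' j' iP jN i'P j'N xyE|i j iP jN].
  have [_ _] := xy i j iP jN; have [_ _] := xy i' j' i'P j'N.
  rewrite -xyE => -> e.
  (* [i] is the remainder of [i + j * P] modulo [P]; then [j] is determined as well. *)
  have ii : i' = i.
    by have := congr1 (modn^~ P) e; rewrite ![(_ + _ * P)%N]addnC !modnMDl !modn_small.
  split=> //; have P0 : (0 < P)%N by apply: leq_ltn_trans iP.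
  by move/eqP: e; rewrite ii eqn_add2l eqn_pmul2r // => /eqP.
by apply: wK; have [xE yE xyE] := xy i j iP jN; rewrite /len xE yE xyE.
Qed.
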